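(* Let $\mathbb{F}$ be a field of characteristic $p>0$, $0\neq h\in\mathbb{F}[x]$, and let $A=A_h$ be the unital subalgebra of the Weyl algebra $A_1$ generated by $x$ and $\hat y=yh$. Let $\mathsf{D}_2:A\oplus A\to A$ be the map $\mathsf{D}_2(\alpha,\beta)=[\beta,x]+[\hat y,\alpha]-F_\alpha(h)$, with $F_\alpha$ as in the context. Then $$\operatorname{im}\mathsf{D}_2=\gcd(h,h')\mathcal{J}\oplus \mathsf{Z}(A)\mathcal{K}h^{p-1}y^{p-1},$$ and consequently, as $\mathsf{Z}(A)$-modules, $$\mathrm{HH}^2(A)\cong \mathcal{J}/\gcd(h,h')\mathcal{J}\ \oplus\ \big(\mathsf{C}_A(x)/\mathsf{Z}(A)\mathcal{K}\big)h^{p-1}y^{p-1}.$$ In particular, $\mathrm{HH}^2(A)\neq 0$ for every $0\neq h\in\mathbb{F}[x]$.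
   Context: The Weyl algebra $A_1$ is generated by $x,y$ with $yx-xy=1$; in $A$ one has $\hat y x-x\hat y=h$, and $h^jy^j\in A$ for all $j\geq0$. $[a,b]=ab-ba$. For $\alpha\in A$, $F_\alpha:\mathbb{F}[x]\to A$ is the linear map with $F_\alpha(x^s)=\sum_{\ell=0}^{s-1}x^\ell\alpha x^{s-\ell-1}$ ($F_\alpha(1)=0$). $\mathsf{Z}(A)$ is the center of $A$ and $\mathsf{C}_A(x)$ the centralizer of $x$ in $A$. $\mathcal{J}=\bigoplus_{j=0}^{p-2}\mathsf{C}_A(x)h^jy^j$. $\varkappa:\mathbb{F}[x]\to\mathbb{F}[x]$ is $\varkappa(g)=g'h-h'g$ and $\mathcal{K}=\operatorname{im}\varkappa$ (a $\mathbb{F}[x^p]$-submodule of $\mathbb{F}[x]\subseteq\mathsf{C}_A(x)$). $\gcd$ is monic. $\mathrm{HH}^2(A)$ is the second Hochschild cohomology of $A$ with coefficients in $A$, a $\mathsf{Z}(A)$-module. *)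

(* Defs.v *)
From HB Require Import structures.
From mathcomp Require Import all_boot all_order all_algebra.
Set Implicit Arguments. Unset Strict Implicit. Unset Printing Implicit Defensive.
Import Order.TTheory GRing.Theory.
Local Open Scope ring_scope.

Section Weyl.
Variable F : fieldType.

(* The Weyl algebra A_1 over F, in normal-ordered form:
   an element  \sum_j f_j(x) y^j  (x's to the left of y's) is represented by
   the polynomial in the outer variable Y with coefficients f_j in F[x]. *)
Definition W := {poly {poly F}}.

(* Weyl product:  (f y^i)(g y^j) = f \sum_k C(i,k) g^{(k)} y^{i+j-k}
   (this encodes the relation yx - xy = 1). *)
Definition wmul (a b : W) : W :=
  \sum_(i < size a) \sum_(j < size b) \sum_(k < i.+1)
     (((a`_i * (b`_j)^`(k)) *+ 'C(i, k))%:P * 'X^(i + j - k)).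

Definition wcomm (a b : W) : W := wmul a b - wmul b a.

Definition wsc (c : F) (a : W) : W := c%:P *: a.

Definition wpol (g : {poly F}) : W := g%:P.
Definition wx : W := wpol 'X.
Definition wy : W := 'X.

Variable h : {poly F}.

Definition yhat : W := wmul wy (wpol h).

Inductive in_A : W -> Prop :=
| inA_one : in_A 1
| inA_x : in_A wx
| inA_yhat : in_A yhat
| inA_scale c a : in_A a -> in_A (wsc c a)
| inA_add a b : in_A a -> in_A b -> in_A (a + b)
| inA_mul a b : in_A a -> in_A b -> in_A (wmul a b).

Definition in_ZA (z : W) : Prop :=
  in_A z /\ forall b, in_A b -> wmul z b = wmul b z.
Definition in_CAx (c : W) : Prop := in_A c /\ wmul c wx = wmul wx c.

Definition Fmap (alpha : W) (g : {poly F}) : W :=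
  \sum_(s < size g) wsc g`_s
     (\sum_(l < s) wmul (wpol 'X^l) (wmul alpha (wpol 'X^(s - l - 1)))).

Definition D2 (alpha beta : W) : W :=
  wcomm beta wx + wcomm yhat alpha - Fmap alpha h.

Definition in_imD2 (w : W) : Prop :=
  exists alpha beta, in_A alpha /\ in_A beta /\ w = D2 alpha beta.

Definition hy (j : nat) : W := (h ^+ j)%:P * 'X^j.

Variable p : nat.

Definition in_J (u : W) : Prop :=
  exists c : nat -> W, (forall j, in_CAx (c j)) /\
    u = \sum_(j < p.-1) wmul (c j) (hy j).

Definition mgcd : {poly F} :=
  (lead_coef (gcdp h h^`()))^-1 *: gcdp h h^`().

Definition in_gcdJ (u : W) : Prop :=
  exists v, in_J v /\ u = wmul (wpol mgcd) v.

Definition in_K (k : {poly F}) : Prop :=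
  exists g : {poly F}, k = g^`() * h - h^`() * g.

Definition in_ZK (w : W) : Prop :=
  exists s : seq (W * {poly F}),
    (forall e, e \in s -> in_ZA e.1 /\ in_K e.2) /\
    w = \sum_(e <- s) wmul e.1 (wpol e.2).

Definition in_ZKpart (w : W) : Prop :=
  exists v, in_ZK v /\ w = wmul v (hy p.-1).

Definition cochain2 (f : W -> W -> W) : Prop :=
  (forall a b, in_A a -> in_A b -> in_A (f a b)) /\
  (forall c a a' b, in_A a -> in_A a' -> in_A b ->
      f (wsc c a + a') b = wsc c (f a b) + f a' b) /\
  (forall c a b b', in_A a -> in_A b -> in_A b' ->
      f a (wsc c b + b') = wsc c (f a b) + f a b').

Definition cocycle2 (f : W -> W -> W) : Prop :=
  cochain2 f /\
  forall a b c, in_A a -> in_A b -> in_A c ->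
    wmul a (f b c) - f (wmul a b) c + f a (wmul b c) - wmul (f a b) c = 0.

Definition coboundary2 (f : W -> W -> W) : Prop :=
  exists g : W -> W,
    (forall a, in_A a -> in_A (g a)) /\
    (forall c a a', in_A a -> in_A a' -> g (wsc c a + a') = wsc c (g a) + g a') /\
    (forall a b, in_A a -> in_A b ->
        f a b = wmul a (g b) - g (wmul a b) + wmul (g a) b).

Definition modN (u v : W * W) : Prop :=
  in_gcdJ (u.1 - v.1) /\ in_ZK (u.2 - v.2).

(* Phi induces a Z(A)-module isomorphism
     HH^2(A) = cocycles/coboundaries  ~=  J/gcd(h,h')J (+) C_A(x)/Z(A)K,
   the second summand being the coefficient of the label h^{p-1} y^{p-1}. *)
Definition HH2_iso (Phi : (W -> W -> W) -> W * W) : Prop :=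
  (forall f, cocycle2 f -> in_J (Phi f).1 /\ in_CAx (Phi f).2) /\
  (forall f g, cocycle2 f -> cocycle2 g ->
     modN (Phi (fun a b => f a b + g a b)) ((Phi f).1 + (Phi g).1, (Phi f).2 + (Phi g).2)) /\
  (forall z f, in_ZA z -> cocycle2 f ->
     modN (Phi (fun a b => wmul z (f a b))) (wmul z (Phi f).1, wmul z (Phi f).2)) /\
  (forall u c, in_J u -> in_CAx c ->
     exists f, cocycle2 f /\ modN (Phi f) (u, c)) /\
  (forall f, cocycle2 f -> (modN (Phi f) (0, 0) <-> coboundary2 f)).

End Weyl.

(* Main.v *)
Require Import Defs.
From mathcomp Require Import all_boot all_order all_algebra ring.
Import GRing.Theory.
Local Open Scope ring_scope.

(* An element w of A_1 lies in A iff h^j divides its coefficient of y^j, so the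
   h^j y^j form an F[x]-basis of A; moreover [-, x] is the derivation d/dy.

   Image of D_2.  The part [beta, x] ranges over d/dy(A).  Modulo d/dy(A),
   F_alpha(h) is h' alpha, and [yhat, a h^k y^k] - F_(a h^k y^k)(h) reduces to
   (a' h - h' a) h^k y^k.  When k is not -1 mod p, these elements together with
   h^(k+1) y^k in d/dy(A) span gcd(h, h') F[x] h^k y^k; when k = -1 mod p,
   d/dy(A) has no component along y^k, and what is left is K h^k y^k.

   Cohomology.  A 2-cocycle f is a square-zero extension of A by A.  Lifting the
   generators x, yhat to the extension, the relation yhat x - x yhat = h fails by
   an element of A, the deviation of f.  Changing the lifts changes it by D_2, and
   since A is presented by this relation the extension splits iff the deviation
   lies in im D_2.  Every m in A is a deviation: use the Ore extension with
   Y x - x Y = h + m.  Hence HH^2(A) = A / im D_2. *)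

(** * The Weyl product as iterated left multiplication by y; ring laws *)

Section WeylProduct.
Set Implicit Arguments. Unset Strict Implicit.
Variable F : fieldType.
Implicit Types (g : {poly F}) (a b c w : {poly {poly F}}).

Local Notation D := (map_poly (@deriv F)).

Lemma innerZ g w : D (g *: w) = g^`() *: w + g *: D w.
Proof. by apply/polyP=> i; rewrite coef_map coefZ coefD !coefZ coef_map /= derivM. Qed.

Lemma innerX w : D (w * 'X) = D w * 'X.
Proof.
by apply/polyP=> i; rewrite coef_map !coefMX coef_map; case: ifP; rewrite // raddf0.
Qed.

(** Left multiplication by y on normal-ordered forms, from y f = f y + f' for f in F[x]. *)
Definition Ly w : {poly {poly F}} := w * 'X + D w.

Lemma LyD a b : Ly (a + b) = Ly a + Ly b.
Proof. by rewrite /Ly raddfD mulrDl addrACA. Qed.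

Lemma Ly0 : Ly 0 = 0.
Proof. by rewrite /Ly raddf0 mul0r addr0. Qed.

Lemma LyZ g w : Ly (g *: w) = g^`() *: w + g *: Ly w.
Proof. by rewrite /Ly innerZ scalerDr scalerAl addrCA. Qed.

Lemma LyX w : Ly (w * 'X) = Ly w * 'X.
Proof. by rewrite /Ly innerX mulrDl. Qed.

Lemma Ly_polyC g : Ly g%:P = g *: 'X + (g^`())%:P.
Proof. by rewrite /Ly mul_polyC map_polyC. Qed.

Lemma iter_LyD i a b : iter i Ly (a + b) = iter i Ly a + iter i Ly b.
Proof. by elim: i => //= i ->; rewrite LyD. Qed.

Lemma iter_Ly0 i : iter i Ly 0 = 0.
Proof. by elim: i => //= i ->; rewrite Ly0. Qed.

Lemma iter_LyX i w : iter i Ly (w * 'X) = iter i Ly w * 'X.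
Proof. by elim: i => //= i ->; rewrite LyX. Qed.

Lemma iter_LyXn i j w : iter i Ly (w * 'X^j) = iter i Ly w * 'X^j.
Proof.
elim: j => [|j IH]; first by rewrite !mulr1.
by rewrite exprSr !mulrA iter_LyX IH.
Qed.

Lemma iter_LyZ (c : F) i w : iter i Ly (c%:P *: w) = c%:P *: iter i Ly w.
Proof. by elim: i => //= i ->; rewrite LyZ derivC scale0r add0r. Qed.

(** Leibniz' rule for y^i g, which is the inner sum of [wmul]. The sums [G] and [H] are the two
    parts of [Ly], joined by Pascal's rule. *)
Lemma iter_Ly_polyC i g :
  iter i Ly g%:P = \sum_(k < i.+1) (g^`(k) *+ 'C(i, k))%:P * 'X^(i - k).
Proof.
elim: i => [|i IH]; first by rewrite big_ord_recl big_ord0 /= addr0 mulr1.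
rewrite /= {}IH (big_morph Ly LyD Ly0).
pose G k : {poly {poly F}} := (g^`(k) *+ 'C(i, k))%:P * 'X^(i.+1 - k).
pose H k : {poly {poly F}} := (g^`(k.+1) *+ 'C(i, k))%:P * 'X^(i - k).
transitivity (\sum_(k < i.+1) G k + \sum_(k < i.+1) H k).
  rewrite -big_split; apply: eq_bigr => -[k /= lt_ki] _.
  rewrite /Ly /G /H subSn // exprSr mulrA; congr (_ + _).
  apply/polyP=> j; rewrite coef_map /= !coefCM !coefXn.
  by case: (j == _); rewrite ?mulr1 ?mulr0 ?derivC // derivMn.
rewrite [RHS]big_ord_recl.
have -> : \sum_(k < i.+1) G k = G 0%N + \sum_(k < i.+1) G k.+1.
  rewrite big_ord_recl; congr (_ + _); rewrite big_ord_recr /= /G.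
  by rewrite bin_small // mulr0n mul0r addr0.
rewrite -addrA -big_split /G !bin0; congr (_ + _); apply: eq_bigr => k _.
by rewrite /= /H subSS binS mulrnDr polyCD mulrDl.
Qed.

(** Replaces the triple sum by iterates of one additive operator; the ring laws below are read off
    from this form. *)
Lemma wmulE a b : wmul a b = \sum_(i < size a) a`_i *: iter i Ly b.
Proof.
rewrite /wmul; apply: eq_bigr => i _.
have Eb : b = \sum_(j < size b) (b`_j)%:P * 'X^j.
  by rewrite -{1}[b]coefK poly_def; apply: eq_bigr => j _; rewrite mul_polyC.
rewrite [in RHS]Eb (big_morph (iter i Ly) (iter_LyD i) (iter_Ly0 i)) scaler_sumr.
apply: eq_bigr => j _; rewrite iter_LyXn iter_Ly_polyC mulr_suml scaler_sumr.
apply: eq_bigr => -[k /= le_ki] _; rewrite -mul_polyC -mulrA -exprD addnBAC //.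
by rewrite -mulrnAr polyCM mulrA.
Qed.

Lemma wmul_widen n a b : (size a <= n)%N ->
  wmul a b = \sum_(i < n) a`_i *: iter i Ly b.
Proof.
move=> le_an; rewrite wmulE (big_ord_widen n (fun i => a`_i *: iter i Ly b)) //.
rewrite big_mkcond; apply: eq_bigr => i _.
by case: ltnP => // /(nth_default 0) ->; rewrite scale0r.
Qed.

Lemma wmulDl a b c : wmul (a + b) c = wmul a c + wmul b c.
Proof.
rewrite (wmul_widen _ (size_polyD a b)).
rewrite (wmul_widen _ (leq_maxl (size a) (size b))).
rewrite (wmul_widen _ (leq_maxr (size a) (size b))) -big_split.
by apply: eq_bigr => i _; rewrite coefD scalerDl.
Qed.

Lemma wmulZl g a b : wmul (g *: a) b = g *: wmul a b.
Proof.
rewrite (wmul_widen _ (size_scale_leq g a)) wmulE scaler_sumr.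
by apply: eq_bigr => i _; rewrite coefZ scalerA.
Qed.

Lemma wmulDr a b c : wmul a (b + c) = wmul a b + wmul a c.
Proof.
rewrite !wmulE -big_split; apply: eq_bigr => i _.
by rewrite iter_LyD scalerDr.
Qed.

Lemma wmulCr (c : F) a b : wmul a (c%:P *: b) = c%:P *: wmul a b.
Proof.
rewrite !wmulE scaler_sumr; apply: eq_bigr => i _.
by rewrite iter_LyZ !scalerA mulrC.
Qed.

Lemma wmul0l a : wmul 0 a = 0.
Proof. by rewrite wmulE size_poly0 big_ord0. Qed.

Lemma wmulNl a b : wmul (- a) b = - wmul a b.
Proof. by rewrite -scaleN1r wmulZl scaleN1r. Qed.

Lemma wmulBl a b c : wmul (a - b) c = wmul a c - wmul b c.
Proof. by rewrite wmulDl wmulNl. Qed.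

Lemma wmulNr a b : wmul a (- b) = - wmul a b.
Proof.
have opp_scale (d : {poly {poly F}}) : - d = (-1 : F)%:P *: d by rewrite polyCN scaleN1r.
by rewrite (opp_scale b) wmulCr -opp_scale.
Qed.

Lemma wmulBr a b c : wmul a (b - c) = wmul a b - wmul a c.
Proof. by rewrite wmulDr wmulNr. Qed.

Lemma wmul0r a : wmul a 0 = 0.
Proof. by rewrite wmulE big1 // => i _; rewrite iter_Ly0 scaler0. Qed.

Lemma wmul_suml I r (P : pred I) (f : I -> {poly {poly F}}) b :
  wmul (\sum_(i <- r | P i) f i) b = \sum_(i <- r | P i) wmul (f i) b.
Proof. exact: (big_morph (fun a => wmul a b) (fun a c => wmulDl a c b) (wmul0l b)). Qed.

Lemma wmul_sumr I r (P : pred I) (f : I -> {poly {poly F}}) a :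
  wmul a (\sum_(i <- r | P i) f i) = \sum_(i <- r | P i) wmul a (f i).
Proof. exact: (big_morph (wmul a) (wmulDr a) (wmul0r a)). Qed.

Lemma wmulXl b : wmul 'X b = Ly b.
Proof.
rewrite wmulE size_polyX !big_ord_recl big_ord0 !coefX /=.
by rewrite scale0r scale1r addr0 add0r.
Qed.

Lemma wmulPl g b : wmul (wpol g) b = g *: b.
Proof.
rewrite (wmul_widen _ (size_polyC_leq1 g)) big_ord_recl big_ord0 coefC /=.
by rewrite addr0.
Qed.

Lemma wmul1l b : wmul 1 b = b.
Proof. by rewrite -[1]/(wpol 1) wmulPl scale1r. Qed.

Lemma wmulXr a b : wmul a (b * 'X) = wmul a b * 'X.
Proof.
rewrite !wmulE mulr_suml; apply: eq_bigr => i _.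
by rewrite iter_LyX scalerAl.
Qed.

Lemma wmul1r a : wmul a 1 = a.
Proof.
rewrite wmulE -[RHS]coefK poly_def; apply: eq_bigr => i _; congr (_ *: _).
elim: (nat_of_ord i) => //= n ->.
have -> : Ly 'X^n = Ly 1 * 'X^n by rewrite -(iter_LyXn 1) mul1r.
by rewrite Ly_polyC scale1r derivC addr0 -exprS.
Qed.

(** Associativity for a left factor y; iterating it gives [wmulA]. The product rule [LyZ] yields
    exactly the two parts of [Ly a]. *)
Lemma wmul_Ly a b : wmul (Ly a) b = Ly (wmul a b).
Proof.
have key c d : wmul (c * 'X) d = \sum_(i < size c) c`_i *: iter i.+1 Ly d.
  rewrite (@wmul_widen (size c).+1) ?big_ord_recl; last first.
    by have [->|c0] := eqVneq c 0; rewrite ?mul0r ?size_poly0 // size_mulX.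
  rewrite coefMX scale0r add0r; apply: eq_bigr => i _.
  by rewrite coefMX.
rewrite wmulDl key (@wmul_widen (size a)) ?size_poly // [in RHS]wmulE.
rewrite (big_morph Ly LyD Ly0) -big_split; apply: eq_bigr => i _.
by rewrite LyZ coef_map addrC.
Qed.

Lemma wmulA a b c : wmul a (wmul b c) = wmul (wmul a b) c.
Proof.
rewrite (wmulE a (wmul b c)) (wmulE a b) wmul_suml; apply: eq_bigr => i _.
by rewrite wmulZl; congr (_ *: _); elim: (nat_of_ord i) => //= n ->; rewrite wmul_Ly.
Qed.

End WeylProduct.

(** * Additive maps on polynomials prescribed on monomials *)

Section CoefficientSums.
Set Implicit Arguments. Unset Strict Implicit.
Variables (R : nzRingType) (V : zmodType) (f : nat -> R -> V).
Hypothesis f_additive : forall j x y, f j (x + y) = f j x + f j y.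
Implicit Types p q : {poly R}.

(** Common shape of [Fmap], of the trivializing cochain and of the constructed cocycle. Additivity
    of each [f j] makes the bound [size p] immaterial. *)
Definition coefsum p := \sum_(j < size p) f j p`_j.

Lemma coefsum_widen n p : (size p <= n)%N -> coefsum p = \sum_(j < n) f j p`_j.
Proof.
move=> le_pn; rewrite /coefsum (big_ord_widen n (fun j => f j p`_j)) //.
rewrite big_mkcond; apply: eq_bigr => j _; case: ltnP => // /(nth_default 0) ->.
by apply: (@addrI _ (f j 0)); rewrite -f_additive !addr0.
Qed.

Lemma coefsumD p q : coefsum (p + q) = coefsum p + coefsum q.
Proof.
rewrite (coefsum_widen (size_polyD p q)).
rewrite (coefsum_widen (leq_maxl (size p) (size q))).
rewrite (coefsum_widen (leq_maxr (size p) (size q))) -big_split.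
by apply: eq_bigr => j _; rewrite coefD f_additive.
Qed.

Lemma coefsum_monomial x j : coefsum (x *: 'X^j) = f j x.
Proof.
have f0 i : f i 0 = 0 by apply: (@addrI _ (f i 0)); rewrite -f_additive !addr0.
have le_size : (size (x *: 'X^j) <= j.+1)%N.
  by rewrite (leq_trans (size_scale_leq _ _)) ?size_polyXn.
rewrite (coefsum_widen le_size) big_ord_recr big1 /= => [|i _].
  by rewrite add0r coefZ coefXn eqxx mulr1.
by rewrite coefZ coefXn (ltn_eqF (ltn_ord i)) mulr0 f0.
Qed.

End CoefficientSums.

(** * The maps F_alpha, the basis h^j y^j of A, and D_2 modulo d/dy(A) *)

Section Algebra.
Set Implicit Arguments. Unset Strict Implicit.
Variables (F : fieldType) (h : {poly F}).
Implicit Types (g : {poly F}) (a b c w : {poly {poly F}}).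

Local Notation D := (map_poly (@deriv F)).

Lemma wmul_X w : wmul w 'X = w * 'X.
Proof. by rewrite -[X in wmul w X]mul1r wmulXr wmul1r. Qed.

(** The derivative of the outer polynomial is d/dy, whereas [D] is d/dx on the coefficients. Each
    step of the induction moves x past one y. *)
Lemma wmul_wx w : wmul w (wx F) = 'X *: w + w^`().
Proof.
elim/poly_ind: w => [|w c IH]; first by rewrite wmul0l !raddf0 addr0.
rewrite derivMXaddC wmulDl -wmul_X -wmulA -/(wpol c) wmulPl wmulXl /wx /wpol Ly_polyC.
rewrite derivX wmulDr wmul1r -mul_polyC wmulXr IH wmul_X -!mul_polyC.
by ring.
Qed.

Lemma wcomm_wx w : wcomm w (wx F) = w^`().
Proof. by rewrite /wcomm wmul_wx wmulPl addrC addKr. Qed.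

Lemma wmul_wpolC w g1 g2 :
  wmul (wmul w (wpol g1)) (wpol g2) = wmul (wmul w (wpol g2)) (wpol g1).
Proof. by rewrite -!wmulA !wmulPl /wpol -!mul_polyC mulrC. Qed.

Lemma deriv_wmulP w g : (wmul w (wpol g))^`() = wmul w^`() (wpol g).
Proof.
by rewrite -!wcomm_wx /wcomm wmul_wpolC -wmulA wmulA wmulBl -!wmulA.
Qed.

Lemma wmul_polyr w g :
  wmul w (wpol g) = \sum_(s < size g) (g`_s)%:P *: wmul w (wpol 'X^s).
Proof.
rewrite -{1}[g]coefK poly_def /wpol rmorph_sum wmul_sumr; apply: eq_bigr => s _.
by rewrite /= -wmulCr -mul_polyC polyCM mul_polyC.
Qed.

Local Notation Fterm a s :=
  (\sum_(l < s) wmul (wpol 'X^l) (wmul a (wpol 'X^(s - l - 1)))).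

Lemma Fterm_additive a s x y :
  wsc (x + y) (Fterm a s) = wsc x (Fterm a s) + wsc y (Fterm a s).
Proof. by rewrite /wsc polyCD scalerDl. Qed.

Lemma FmapD a g1 g2 : Fmap a (g1 + g2) = Fmap a g1 + Fmap a g2.
Proof. exact: (coefsumD (fun j x y => Fterm_additive a j x y)). Qed.

Lemma FmapZ a x g : Fmap a (x *: g) = x%:P *: Fmap a g.
Proof.
rewrite [LHS](coefsum_widen (fun j x y => Fterm_additive a j x y) (size_scale_leq x g)).
rewrite scaler_sumr; apply: eq_bigr => s _.
by rewrite coefZ /wsc polyCM scalerA.
Qed.

(** Horner recursion for [Fmap]: in F_a(x^(s+1)) the term l = 0 is a x^s, and the others are x times
    F_a(x^s). *)
Lemma FmapMXaddC a g x : Fmap a (g * 'X + x%:P) = wmul a (wpol g) + 'X *: Fmap a g.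
Proof.
have le_size : (size (g * 'X + x%:P)%R <= (size g).+1)%N.
  rewrite size_MXaddC; by case: ifP.
rewrite [LHS](coefsum_widen (fun j x y => Fterm_additive a j x y) le_size).
rewrite big_ord_recl big_ord0 /wsc scaler0 add0r wmul_polyr scaler_sumr -big_split.
apply: eq_bigr => s _; rewrite coefD coefMX coefC /= addr0 scalerA mulrC -scalerA -scalerDr.
congr (_ *: _); rewrite big_ord_recl wmulPl scale1r subn0 subn1 /=; congr (_ + _).
rewrite scaler_sumr; apply: eq_bigr => l _.
by rewrite !wmulPl scalerA -exprS subSS.
Qed.

Lemma FmapC a x : Fmap a x%:P = 0.
Proof.
by rewrite -[x%:P]add0r -(mul0r 'X) FmapMXaddC wmul0r /Fmap size_poly0 big_ord0 scaler0 addr0.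
Qed.

Lemma FmapX a : Fmap a 'X = a.
Proof.
by rewrite -['X]mul1r -[1 * 'X]addr0 -polyC0 FmapMXaddC wmul1r FmapC scaler0 addr0.
Qed.

(** Identifies [Fmap a] as the derivation from F[x] to the Weyl algebra that sends x to [a]. *)
Lemma Fmap_Leibniz a g1 g2 :
  Fmap a (g1 * g2) = g1 *: Fmap a g2 + wmul (Fmap a g1) (wpol g2).
Proof.
elim/poly_ind: g1 => [|g1 x IH].
  by rewrite mul0r -polyC0 !FmapC wmul0l scale0r addr0.
rewrite mulrDl mulrAC mul_polyC FmapD FmapZ -[X in Fmap a X]addr0 -polyC0.
rewrite !FmapMXaddC IH wmulDl wmulZl -wmulA wmulPl /wpol.
by rewrite -!mul_polyC polyCM; ring.
Qed.

(* The Leibniz rule for [w, -] on F[x]. *)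
Lemma wcomm_Fmap w g : wcomm w (wpol g) = Fmap w^`() g.
Proof.
elim/poly_ind: g => [|g x IH].
  by rewrite -polyC0 FmapC /wcomm wmul0l wmul0r subrr.
rewrite FmapMXaddC -IH -wcomm_wx /wcomm /wpol !polyCD wmulDl wmulDr.
have -> : wmul w x%:P%:P = wmul x%:P%:P w.
  by rewrite wmulPl -[x%:P%:P]mulr1 mul_polyC wmulCr wmul1r.
have -> : wmul w (g * 'X)%:P = wmul (wmul w (wx F)) (wpol g).
  by rewrite -wmulA wmulPl /wpol mulrC polyCM mul_polyC.
by rewrite !(wmulDl, wmulNl) -wmulA !wmulPl wmulZl -!mul_polyC !polyCM; ring.
Qed.

Lemma deriv_Fmap a g : (Fmap a g)^`() = Fmap a^`() g.
Proof.
elim/poly_ind: g => [|g x IH]; first by rewrite -polyC0 !FmapC raddf0.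
by rewrite !FmapMXaddC derivD deriv_wmulP derivZ IH.
Qed.

(** The commutator [w, g] is F with parameter dw/dy, and d/dy passes through F. So moving a
    polynomial to the left costs only a y-derivative. *)
Lemma wmul_wpolr w g : wmul w (wpol g) = g *: w + (Fmap w g)^`().
Proof. by rewrite deriv_Fmap -wcomm_Fmap /wcomm !wmulPl addrC subrK. Qed.

Lemma yhatE : yhat h = h *: 'X + (h^`())%:P.
Proof. by rewrite /yhat wmulXl Ly_polyC. Qed.

Lemma wmul_yhat w : wmul (yhat h) w = h *: Ly w + h^`() *: w.
Proof. by rewrite yhatE wmulDl wmulZl wmulXl -/(wpol _) wmulPl. Qed.

Lemma coef_hy j i : (hy h j)`_i = if i == j then h ^+ j else 0.
Proof. by rewrite /hy coefCM coefXn; case: eqP; rewrite ?mulr1 ?mulr0. Qed.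

Lemma coefZhy g j i : (g *: hy h j)`_i = if i == j then g * h ^+ j else 0.
Proof. by rewrite coefZ coef_hy; case: eqP; rewrite ?mulr0. Qed.

(** Differentiating h^j gives j copies of h', and [yhat] = h y + h' gives one more. Solved for
    h^(j+1) y^(j+1), this is the recursion behind the later constructions on the basis. *)
Lemma yhat_hy j : wmul (yhat h) (hy h j) = hy h j.+1 + (j.+1%:R * h^`()) *: hy h j.
Proof.
rewrite wmul_yhat /Ly; apply/polyP=> i.
rewrite !coefD !coefZ coefD coefMX coef_map /= !coef_hy.
have [-> | ne_ij] := eqVneq i j; last first.
  rewrite raddf0 !mulr0 !addr0; case: i ne_ij => [|i] ne_ij; rewrite ?mulr0 //=.
  by rewrite eqSS; case: eqP => _; rewrite ?mulr0 // exprS.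
rewrite (ltn_eqF (ltnSn j)).
rewrite (_ : (if j == 0%N then 0 else _) = 0); last first.
  by case: j => //= j; rewrite ltn_eqF.
rewrite deriv_exp; case: j => [|j]; first by rewrite !expr0; ring.
by rewrite /= exprS; ring.
Qed.

Lemma inA0 : in_A h 0.
Proof. by have := inA_scale 0 (inA_one h); rewrite /wsc scale0r. Qed.

Lemma inA_wpol g : in_A h (wpol g).
Proof.
elim/poly_ind: g => [|g x IH]; first exact: inA0.
rewrite /wpol polyCD polyCM; apply: inA_add.
  by rewrite mul_polyC -wmulPl; apply: inA_mul => //; apply: inA_x.
by rewrite -[x%:P%:P]mulr1 mul_polyC; apply/inA_scale/inA_one.
Qed.

Lemma inA_Z g w : in_A h w -> in_A h (g *: w).
Proof. by rewrite -wmulPl; apply/inA_mul/inA_wpol. Qed.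

Lemma inA_N w : in_A h w -> in_A h (- w).
Proof. by rewrite -scaleN1r; apply: inA_Z. Qed.

Lemma inA_B a b : in_A h a -> in_A h b -> in_A h (a - b).
Proof. by move=> Aa Ab; apply/inA_add/inA_N. Qed.

Lemma inA_sum I (r : seq I) (P : pred I) (f : I -> {poly {poly F}}) :
  (forall i, P i -> in_A h (f i)) -> in_A h (\sum_(i <- r | P i) f i).
Proof. by move=> Af; apply: big_ind => //; [apply: inA0 | apply: inA_add]. Qed.

Lemma inA_hy j : in_A h (hy h j).
Proof.
elim: j => [|j IH]; first by rewrite /hy !expr0 mulr1; apply: inA_one.
have -> : hy h j.+1 = wmul (yhat h) (hy h j) - (j.+1%:R * h^`()) *: hy h j.
  by rewrite yhat_hy addrK.
by apply: inA_B; [apply/inA_mul/IH/inA_yhat | apply: inA_Z].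
Qed.

Lemma hy_expansion w : (forall j, h ^+ j %| w`_j) ->
  w = \sum_(j < size w) (w`_j %/ h ^+ j) *: hy h j.
Proof.
move=> Aw; rewrite -{1}[w]coefK poly_def; apply: eq_bigr => j _.
by rewrite /hy mul_polyC scalerA divpK.
Qed.

Lemma inAP w : in_A h w <-> forall j, h ^+ j %| w`_j.
Proof.
split=> [Aw | /hy_expansion ->]; last first.
  by apply: inA_sum => j _; apply/inA_Z/inA_hy.
(* To make the product case of the induction work, the claim is strengthened: left multiplication by
   [w] preserves the divisibility condition. *)
suff: forall b, (forall j, h ^+ j %| b`_j) -> forall j, h ^+ j %| (wmul w b)`_j.
  move/(_ 1); rewrite wmul1r; apply => j.
  by rewrite coef1; case: j => [|j]; rewrite ?expr0 ?dvdp0.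
elim: Aw => [|||c a _ IH|a b _ IHa _ IHb|a b _ IHa _ IHb] d Hd j.
- by rewrite wmul1l.
- by rewrite wmulPl coefZ dvdp_mull.
- rewrite wmul_yhat !(coefD, coefZ) coefMX coef_map /=.
  apply: dvdp_add; last by rewrite dvdp_mull.
  rewrite mulrDr; apply: dvdp_add.
    by case: j => [|j]; rewrite ?mulr0 ?dvdp0 //= exprS dvdp_mul.
  have /dvdpP[q ->] := Hd j; rewrite derivM deriv_exp mulrDr; apply: dvdp_add.
    by rewrite mulrA dvdp_mull.
  case: j {Hd} => [|j]; first by rewrite expr0 dvd1p.
  rewrite [X in _ %| X](_ : _ = (q * h^`() *+ j.+1) * h ^+ j.+1) ?dvdp_mull //.
  by rewrite /= exprS !mulrnAr mulrnAl; congr (_ *+ _); ring.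
- by rewrite /wsc wmulZl coefZ dvdp_mull ?IH.
- by rewrite wmulDl coefD dvdp_add ?IHa ?IHb.
by rewrite -wmulA; apply: IHa => i; apply: IHb.
Qed.

Lemma inA_ind_hy (P : {poly {poly F}} -> Prop) :
  (forall g j, P (g *: hy h j)) ->
  (forall a b, in_A h a -> in_A h b -> P a -> P b -> P (a + b)) ->
  forall w, in_A h w -> P w.
Proof.
move=> Pgen PD w /inAP/hy_expansion ->.
suff [] : in_A h (\sum_(j < size w) (w`_j %/ h ^+ j) *: hy h j) /\
       P (\sum_(j < size w) (w`_j %/ h ^+ j) *: hy h j) by [].
apply: (big_ind (fun v => in_A h v /\ P v)) => [|a b [Aa Pa] [Ab Pb]|j _].
- by split; [apply: inA0 | rewrite -(scale0r (hy h 0)); apply: Pgen].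
- by split; [apply: inA_add | apply: PD].
by split; [apply/inA_Z/inA_hy | apply: Pgen].
Qed.

Lemma inA_derivMX w : in_A h w -> in_A h (w * 'X)^`().
Proof.
move=> /inAP Aw; apply/inAP => j.
by rewrite coef_deriv coefMX -mulr_natl dvdp_mull.
Qed.

Lemma inA_Fmap a g : in_A h a -> in_A h (Fmap a g).
Proof.
move=> Aa; elim/poly_ind: g => [|g x IH]; first by rewrite -polyC0 FmapC; apply: inA0.
rewrite FmapMXaddC; apply: inA_add; last exact: inA_Z.
by apply/inA_mul/inA_wpol.
Qed.

(** By [wmul_wpolr], modulo d/dy(A) all s terms of F_a(x^s) become x^(s-1) a. *)
Lemma Fmap_mod_deriv a g : in_A h a ->
  exists2 e, in_A h e & Fmap a g = g^`() *: a + e^`().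
Proof.
move=> Aa; elim/poly_ind: g => [|g x [e Ae IH]].
  by exists 0; rewrite ?raddf0 -?polyC0 ?FmapC ?scale0r ?addr0 //; apply: inA0.
exists (Fmap a g + 'X *: e); first by apply: inA_add; [apply: inA_Fmap | apply: inA_Z].
rewrite FmapMXaddC wmul_wpolr {2}IH derivMXaddC derivD derivZ -!mul_polyC polyCD polyCM.
by ring.
Qed.

Definition D2_main a := h *: D a - h^`() *: (a * 'X)^`().

Lemma D2_mod_deriv a : in_A h a ->
  exists2 e, in_A h e & forall b, D2 h a b = D2_main a + (b + e)^`().
Proof.
move=> Aa; have [e1 Ae1 E1] := Fmap_mod_deriv h Aa.
have [e2 Ae2 E2] := Fmap_mod_deriv h (inA_derivMX Aa).
exists (- e1 - e2); first by apply: inA_B => //; apply: inA_N.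
move=> b; rewrite /D2 wcomm_wx /wcomm wmul_yhat.
(* As [yhat] = y h, one has a yhat = (a y) h. The commutator [a y, h] is F_b(h) with b = d(a y)/dy,
   and b lies in A even when a y does not. *)
have -> : wmul a (yhat h) = h *: (a * 'X) + wcomm (a * 'X) (wpol h).
  by rewrite /wcomm wmulPl addrC subrK /yhat /wy wmulA wmul_X.
rewrite wcomm_Fmap E1 E2 /D2_main /Ly !derivD !derivN -!mul_polyC.
by ring.
Qed.

(** The term k h' g h^k from (h^k)' cancels against part of the factor k + 1 from d(a y)/dy, so h' g
    survives exactly once, whatever k is. *)
Lemma coef_D2_main a g k :
  a`_k = g * h ^+ k -> (D2_main a)`_k = (g^`() * h - h^`() * g) * h ^+ k.
Proof.
move=> Eak; rewrite /D2_main coefB !coefZ coef_map coef_deriv coefMX /= Eak.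
rewrite derivM deriv_exp -mulr_natl; case: k {Eak} => [|k]; first by rewrite expr0; ring.
by rewrite /= exprS -[_ *+ k.+2]mulr_natl; ring.
Qed.

End Algebra.

(** * Centralizer, center, J and K read on coefficients; the image of D_2 *)

Section Image.
Set Implicit Arguments. Unset Strict Implicit.
Variables (F : fieldType) (h : {poly F}) (p : nat).
Hypotheses (pcharF : p \in [pchar F]) (h0 : h != 0).
Implicit Types (g : {poly F}) (a b c u v w z : {poly {poly F}}).

Local Notation D := (map_poly (@deriv F)).

Lemma p_gt0 : (0 < p)%N.
Proof. exact/prime_gt0/(pcharf_prime pcharF). Qed.

Lemma natr_poly_eq0 n : (n%:R == 0 :> {poly F}) = (p %| n)%N.
Proof. by rewrite (dvdn_pcharf (rmorph_pchar (@polyC F) pcharF)). Qed.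

Lemma mulrn_poly_eq0 g n : (g *+ n == 0) = (p %| n)%N || (g == 0).
Proof. by rewrite -mulr_natl mulf_eq0 natr_poly_eq0. Qed.

Lemma deriv_eq0P w : w^`() = 0 <-> forall k, ~~ (p %| k)%N -> w`_k = 0.
Proof.
split=> [dw [|k] | w0]; first by rewrite dvdn0.
  move=> /negPf pk; have /eqP := congr1 (fun v : {poly {poly F}} => v`_k) dw.
  by rewrite coef_deriv coef0 mulrn_poly_eq0 pk => /eqP.
apply/polyP=> k; rewrite coef_deriv coef0; apply/eqP; rewrite mulrn_poly_eq0.
by case: (boolP (p %| k.+1)%N) => //= /w0 ->.
Qed.

Lemma Fmap0l g : Fmap 0 g = 0 :> {poly {poly F}}.
Proof.
elim/poly_ind: g => [|g x IH]; first by rewrite -polyC0 FmapC.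
by rewrite FmapMXaddC IH scaler0 wmul0l addr0.
Qed.

(** Such a [c] commutes with x, hence with F[x], so no correction terms appear and the commutative
    product of normal forms can be used. *)
Lemma wmul_CAx c w : c^`() = 0 -> wmul c w = c * w.
Proof.
move=> dc; elim/poly_ind: w => [|w g IH]; first by rewrite wmul0r mulr0.
rewrite wmulDr wmulXr IH -/(wpol g) wmul_wpolr deriv_Fmap dc Fmap0l.
by rewrite -!mul_polyC; ring.
Qed.

Lemma in_CAxP c : in_CAx h c <-> in_A h c /\ c^`() = 0.
Proof.
rewrite /in_CAx -wcomm_wx /wcomm; split=> -[Ac Ec]; split=> //.
  by rewrite Ec subrr.
exact: subr0_eq.
Qed.

(** Commuting with x gives dz/dy = 0; commuting with [yhat] then leaves h D z = 0, and h is nonzero.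
    Conversely, if D z = 0, then [Ly] acts on z y^n as multiplication by y. *)
Lemma in_ZAP z : in_ZA h z <-> [/\ in_A h z, z^`() = 0 & D z = 0].
Proof.
split=> [[Az Cz] | [Az dz Dz]].
  have [_ dz] : in_A h z /\ z^`() = 0 by apply/in_CAxP; split=> //; apply/Cz/inA_x.
  split=> //; have := Cz _ (inA_yhat h); rewrite wmul_yhat wmul_CAx // yhatE /Ly.
  move=> E; have : h *: D z = 0.
    by rewrite -(subrr (z * (h *: 'X + h^`()%:P))) {1}E -!mul_polyC; ring.
  by move/eqP; rewrite -mul_polyC mulf_eq0 polyC_eq0 (negPf h0) => /eqP.
split=> // b _; rewrite wmul_CAx // wmulE -{1}[b]coefK poly_def mulr_sumr.
apply: eq_bigr => i _; rewrite -scalerAr; congr (_ *: _).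
elim: (nat_of_ord i) => [|n IH]; first by rewrite mulr1.
rewrite iterS -IH (iter_LyXn 1 n z : Ly (z * 'X^n) = Ly z * 'X^n).
by rewrite /Ly Dz addr0 -mulrA -exprS.
Qed.

Lemma coef_mul_hy c j k :
  (c * hy h j)`_k = if (k < j)%N then 0 else c`_(k - j) * h ^+ j.
Proof. by rewrite /hy mulrA coefMXn; case: ifP; rewrite ?coefMC. Qed.

(** Each [c j] involves only powers y^i with p | i, so only j = k mod p contributes to y^k. *)
Lemma coef_CAx_sum n (c : nat -> {poly {poly F}}) k :
  (n <= p)%N -> (forall j, (c j)^`() = 0) ->
  (\sum_(j < n) c j * hy h j)`_k =
  if (k %% p < n)%N then (c (k %% p)%N)`_(k - k %% p) * h ^+ (k %% p) else 0.
Proof.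
move=> le_np dc; rewrite coef_sum.
have term0 (j : 'I_n) : j != (k %% p)%N :> nat -> (c j * hy h j)`_k = 0.
  move=> ne_j; rewrite coef_mul_hy; case: ltnP => // le_jk.
  have /deriv_eq0P-> := dc j; first by rewrite mul0r.
  apply: contra ne_j => /dvdnP[q Eq]; rewrite -(subnK le_jk) Eq modnMDl.
  by rewrite modn_small // (leq_trans (ltn_ord j)).
case: ltnP => [lt_kn | le_nk]; last first.
  rewrite big1 // => j _; apply: term0.
  by rewrite neq_ltn (leq_trans (ltn_ord j)).
rewrite (bigD1 (Ordinal lt_kn)) //= big1 => [|j ne_j]; last first.
  by apply: term0; apply: contra ne_j => /eqP Ej; apply/eqP/val_inj.
by rewrite addr0 coef_mul_hy ltnNge leq_mod.
Qed.

(* The coefficient in C_A(x) of the basis vector h^j y^j of A. *)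
Definition CAx_coef j w : {poly {poly F}} :=
  \poly_(i < size w) (if (p %| i)%N then w`_(i + j) %/ h ^+ j else 0).

Lemma coef_CAx_coef j w i :
  (CAx_coef j w)`_i = if (p %| i)%N then w`_(i + j) %/ h ^+ j else 0.
Proof.
rewrite coef_poly; case: ltnP => // le_wi.
by rewrite nth_default ?div0p ?if_same // (leq_trans le_wi) ?leq_addr.
Qed.

Lemma in_CAx_coef j w : in_A h w -> in_CAx h (CAx_coef j w).
Proof.
move=> /inAP Aw; apply/in_CAxP; split.
  apply/inAP => i; rewrite coef_CAx_coef; case: ifP => _; last exact: dvdp0.
  have /dvdpP[q ->] := Aw (i + j)%N.
  by rewrite exprD mulrA mulpK ?expf_neq0 // dvdp_mull.
by apply/deriv_eq0P => i /negPf pi; rewrite coef_CAx_coef pi.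
Qed.

Lemma CAx_decomposition w : in_A h w -> w = \sum_(j < p) CAx_coef j w * hy h j.
Proof.
move=> Aw; have CAw j := in_CAx_coef j Aw.
apply/polyP=> k; rewrite (@coef_CAx_sum p (CAx_coef^~ w)) // => [|j]; last first.
  by have /in_CAxP[] := CAw j.
rewrite ltn_pmod ?p_gt0 // coef_CAx_coef subnK ?leq_mod //.
rewrite (_ : (p %| k - k %% p)%N); last first.
  by rewrite {1}(divn_eq k p) addnK dvdn_mull.
rewrite divpK //; have /inAP := Aw => /(_ k); apply: dvdp_trans.
by rewrite dvdp_exp2l // leq_mod.
Qed.

Lemma CAx_coef_sum n (c : nat -> {poly {poly F}}) j :
  (n <= p)%N -> (forall i, in_CAx h (c i)) -> (j < n)%N ->
  CAx_coef j (\sum_(i < n) c i * hy h i) = c j.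
Proof.
move=> le_np Cc lt_jn; have dc i : (c i)^`() = 0 by have /in_CAxP[] := Cc i.
apply/polyP=> k; rewrite coef_CAx_coef; case: ifPn => [pk | npk]; last first.
  by have /deriv_eq0P-> := dc j.
have Ej : ((k + j) %% p = j)%N by rewrite -modnDml (eqP pk) modn_small ?(leq_trans lt_jn).
by rewrite coef_CAx_sum // Ej lt_jn addnK mulpK ?expf_neq0.
Qed.

Lemma modn_predp (k : nat) : (k %% p == p.-1)%N = (p %| k.+1)%N.
Proof.
have Ep := prednK p_gt0; rewrite -[k.+1]addn1 /dvdn -modnDml.
have := ltn_pmod k p_gt0; rewrite -{2}Ep ltnS leq_eqVlt.
case/orP=> [/eqP-> | lt_kp]; first by rewrite eqxx addn1 Ep modnn.
have lt_k1p : ((k %% p).+1 < p)%N by rewrite -[X in (_ < X)%N]Ep.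
by rewrite (ltn_eqF lt_kp) addn1 modn_small.
Qed.

(** J lacks just the summand j = p - 1 of A, which carries the powers y^k with k = -1 mod p. *)
Lemma in_JP u : in_J h p u <-> in_A h u /\ forall k, (p %| k.+1)%N -> u`_k = 0.
Proof.
have Ep := prednK p_gt0.
split=> [[c [Cc ->]] | [Au u0]].
  have Cd j : (c j)^`() = 0 by have /in_CAxP[] := Cc j.
  under eq_bigr do rewrite wmul_CAx //; split=> [|k].
    apply: inA_sum => j _; rewrite -wmul_CAx //.
    by apply: inA_mul (inA_hy h j); have [] := Cc j.
  by rewrite -modn_predp => /eqP Ek; rewrite coef_CAx_sum ?leq_pred // Ek ltnn.
exists (fun j => CAx_coef j u); split=> [j|]; first exact: in_CAx_coef.
under eq_bigr do rewrite wmul_CAx ?(proj2 (proj1 (in_CAxP _) (in_CAx_coef _ Au))) //.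
rewrite {1}(CAx_decomposition Au) -Ep big_ord_recr /= [X in _ + X](_ : _ = 0) ?addr0 //.
apply/polyP=> k; rewrite coef_mul_hy coef_CAx_coef coef0; case: ltnP => // le_pk.
case: ifP => pk; rewrite ?mul0r // subnK // u0 ?div0p ?mul0r //.
by rewrite -[k.+1]addn1 -(subnK le_pk) -addnA addn1 Ep dvdn_addl.
Qed.

Local Notation d := (mgcd h).

Lemma mgcd_eqp : d %= gcdp h h^`().
Proof.
rewrite /mgcd eqp_scale // invr_eq0 lead_coef_eq0 gcdp_eq0 negb_and.
by rewrite h0.
Qed.

Lemma mgcd_neq0 : d != 0.
Proof. by rewrite -dvd0p (eqp_dvdr _ mgcd_eqp) dvd0p gcdp_eq0 negb_and h0. Qed.

Lemma mgcd_dvdl : d %| h.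
Proof. by rewrite (eqp_dvdl _ mgcd_eqp) dvdp_gcdl. Qed.

Lemma mgcd_dvdr : d %| h^`().
Proof. by rewrite (eqp_dvdl _ mgcd_eqp) dvdp_gcdr. Qed.

Lemma mgcd_Bezout : exists s t, d = s * h + t * h^`().
Proof.
have [[s t] /= Est] := Bezoutp h h^`().
have : s * h + t * h^`() %| d by rewrite (eqp_dvdl _ Est) (eqp_dvdr _ mgcd_eqp).
case/dvdpP=> q Eq; exists (q * s), (q * t).
by rewrite {1}Eq mulrDr !mulrA.
Qed.

Lemma in_gcdJP u : in_gcdJ h p u <->
  forall k, d * h ^+ k %| u`_k /\ ((p %| k.+1)%N -> u`_k = 0).
Proof.
split=> [[v [/in_JP[/inAP Av v0] ->]] k | Hu].
  by rewrite wmulPl coefZ dvdp_mul //; split=> // /v0 ->; rewrite mulr0.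
have Eu k : u`_k = d * (u`_k %/ d).
  by rewrite mulrC divpK //; apply: dvdp_trans (Hu k).1; rewrite dvdp_mulr.
exists (\poly_(k < size u) (u`_k %/ d)).
have Ev k : (\poly_(k < size u) (u`_k %/ d))`_k = u`_k %/ d.
  by rewrite coef_poly; case: ltnP => // le_uk; rewrite nth_default ?div0p.
split; last by rewrite wmulPl; apply/polyP=> k; rewrite coefZ Ev -Eu.
apply/in_JP; split=> [|k pk]; last by rewrite Ev (Hu k).2 // div0p.
by apply/inAP => k; rewrite Ev -(dvdp_mul2l _ _ mgcd_neq0) -Eu (Hu k).1.
Qed.

Lemma in_K0 : in_K h 0.
Proof. by exists 0; rewrite raddf0 mul0r mulr0 subrr. Qed.

Lemma in_KD g1 g2 : in_K h g1 -> in_K h g2 -> in_K h (g1 + g2).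
Proof. by move=> [k1 ->] [k2 ->]; exists (k1 + k2); rewrite derivD; ring. Qed.

Lemma in_K_const g1 g2 : g1^`() = 0 -> in_K h g2 -> in_K h (g1 * g2).
Proof. by move=> dg [k ->]; exists (g1 * k); rewrite derivM dg; ring. Qed.

Definition coefs_in_K w := forall k, exists2 g, in_K h g & w`_k = g * h ^+ k.

(** A central z has coefficients q h^k with p | k and q' = 0, and K is stable under multiplication
    by such q. Conversely h^k y^k is central for p | k. *)
Lemma in_ZKP w : in_ZK h w <-> w^`() = 0 /\ coefs_in_K w.
Proof.
split=> [[s [Hs ->]] | [/deriv_eq0P w0 Kw]].
  elim: s Hs => [|[z g] s IH] Hs.
    rewrite big_nil raddf0; split=> // k; exists 0; rewrite ?coef0 ?mul0r //.
    exact: in_K0.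
  have [|/= dw Kw] := IH; first by move=> e es; apply: Hs; rewrite inE es orbT.
  have [/in_ZAP[/= /inAP Az dz Dz] Kg] := Hs (z, g) (mem_head _ _).
  rewrite big_cons /= wmul_CAx // derivD derivM dz dw derivC mul0r mulr0 !addr0.
  split=> // k; have [g1 Kg1 Eg1] := Kw k; have /dvdpP[q Eq] := Az k.
  exists (q * g + g1); last by rewrite coefD coefMC Eq Eg1; ring.
  case: (boolP (p %| k)%N) => [pk | /(proj1 (deriv_eq0P z) dz) zk].
    apply: in_KD => //; apply: in_K_const Kg; apply/eqP.
    have := congr1 (fun v : {poly {poly F}} => v`_k) Dz.
    rewrite coef_map coef0 Eq /= derivM deriv_exp => /eqP.
    have /eqP-> : h^`() * h ^+ k.-1 *+ k == 0 by rewrite mulrn_poly_eq0 pk.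
    by rewrite mulr0 addr0 mulf_eq0 (negPf (expf_neq0 _ h0)) orbF.
  move: zk; rewrite Eq => /eqP; rewrite mulf_eq0 (negPf (expf_neq0 _ h0)) orbF.
  by move=> /eqP->; rewrite mul0r add0r.
have /fin_all_exists[g Hg] : forall k : 'I_(size w), exists g, in_K h g /\ w`_k = g * h ^+ k.
  by move=> k; have [g] := Kw k; exists g.
exists [seq (hy h (nat_of_ord k), g k) | k : 'I_(size w) <-
  [seq k : 'I_(size w) <- index_enum 'I_(size w) | (p %| nat_of_ord k)%N]].
split=> [e /mapP[k] | ].
  rewrite mem_filter => /andP[pk _] -> /=; have [Kg _] := Hg k; split=> //.
  apply/in_ZAP; split; first exact: inA_hy.
    by apply/deriv_eq0P => i; rewrite coef_hy; case: eqP => // ->; rewrite pk.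
  apply/polyP=> i; rewrite coef_map coef_hy coef0; case: eqP => _; last exact: raddf0.
  by apply/eqP; rewrite /= deriv_exp mulrn_poly_eq0 pk.
rewrite big_map big_filter /= -{1}[w]coefK poly_def [RHS]big_mkcond.
apply: eq_bigr => k _ /=; have [Kg ->] := Hg k; case: ifPn => [pk | /w0 wk].
  rewrite wmul_CAx /hy /wpol -?mul_polyC ?polyCM; first by ring.
  apply/deriv_eq0P => i; rewrite -/(hy h k) coef_hy; case: eqP => // ->; rewrite pk.
  by [].
by have [_ <-] := Hg k; rewrite wk scale0r.
Qed.

Lemma in_ZKpartP v : in_ZKpart h p v <->
  coefs_in_K v /\ forall k, ~~ (p %| k.+1)%N -> v`_k = 0.
Proof.
have Ep := prednK p_gt0.
split=> [[c [/in_ZKP[dc Kc] ->]] | [Kv v0]].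
  rewrite wmul_CAx //; split=> k; rewrite coef_mul_hy.
    case: ltnP => [_ | le_pk].
      by exists 0; rewrite ?mul0r //; apply: in_K0.
    have [g Kg ->] := Kc (k - p.-1)%N; exists g => //.
    by rewrite -mulrA -exprD subnK.
  case: ltnP => // le_pk npk; have /deriv_eq0P-> := dc; first by rewrite mul0r.
  apply: contra npk => pk.
  by rewrite -[k.+1]addn1 -(subnK le_pk) -addnA addn1 Ep dvdn_addl.
have Av : in_A h v by apply/inAP => k; have [g _ ->] := Kv k; rewrite dvdp_mull.
have /in_CAxP[_ dc] := in_CAx_coef p.-1 Av.
exists (CAx_coef p.-1 v); rewrite wmul_CAx //; split.
  apply/in_ZKP; split=> // k; rewrite coef_CAx_coef; case: ifP => _.
    have [g Kg ->] := Kv (k + p.-1)%N; exists g => //.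
    by rewrite exprD mulrA mulpK ?expf_neq0.
  by exists 0; rewrite ?mul0r //; apply: in_K0.
rewrite {1}(CAx_decomposition Av) -Ep big_ord_recr /= big1 ?add0r // => j _.
apply/polyP=> k; rewrite coef_mul_hy coef_CAx_coef coef0; case: ltnP => // le_jk.
case: ifP => pk; rewrite ?mul0r // subnK // v0 ?div0p ?mul0r //.
rewrite -modn_predp -(subnK le_jk) -modnDml (eqP pk) add0n modn_small.
  by rewrite ltn_eqF.
by rewrite (leq_trans (ltn_ord j)) ?leq_pred.
Qed.

(** The image can be computed one power of y at a time, because [D2_main] acts on each coefficient
    separately and d/dy only shifts degrees. *)
Lemma in_imD2P w : in_imD2 h w <->
  forall k, if (p %| k.+1)%N then exists2 g, in_K h g & w`_k = g * h ^+ k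
            else d * h ^+ k %| w`_k.
Proof.
split=> [[a [b [Aa [Ab ->]]]] k | Hw].
  have [e Ae ->] := D2_mod_deriv Aa; rewrite coefD coef_deriv.
  have /inAP/(_ k)/dvdpP[g Eg] := Aa; rewrite (coef_D2_main Eg).
  have /inAP/(_ k.+1)/dvdpP[q ->] := inA_add Ab Ae.
  have [pk | npk] := ifPn.
    have /eqP-> : q * h ^+ k.+1 *+ k.+1 == 0 by rewrite mulrn_poly_eq0 pk.
    by rewrite addr0; eexists; last by []; exists g.
  rewrite -mulrnAl exprS mulrA -mulrDl dvdp_mul // !dvdp_add ?dvdpNr //.
  - by rewrite dvdp_mull ?mgcd_dvdl.
  - by rewrite dvdp_mulr ?mgcd_dvdr.
  by rewrite dvdp_mull ?mgcd_dvdl.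
have [s [t Ed]] := mgcd_Bezout.
have step k : exists gq : {poly F} * {poly F},
    ((p %| k.+1)%N -> gq.2 = 0) /\
    w`_k = (gq.1^`() * h - h^`() * gq.1) * h ^+ k + gq.2 * h ^+ k.+1.
  have := Hw k; have [pk [_ [g ->] ->] | npk /dvdpP[q ->]] := ifPn.
    by exists (g, 0); rewrite mul0r addr0.
  (* With d = s h + t h', the choice -(q t) produces the part q t h' together with the unwanted -(q
     t)' h; the second component restores the latter and adds q s h. *)
  exists (- (q * t), q * s + (q * t)^`()) => /=; split; first by move/negP: npk.
  by rewrite derivN {1}Ed exprS; ring.
have [G HG G0] : exists2 G, forall k,
    ((p %| k.+1)%N -> (G k).2 = 0) /\
    w`_k = ((G k).1^`() * h - h^`() * (G k).1) * h ^+ k + (G k).2 * h ^+ k.+1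
  & forall k, (size w <= k)%N -> G k = (0, 0).
  have /fin_all_exists[gq Hgq] := fun k : 'I_(size w) => step k.
  exists (fun k => if insub k is Some i then gq i else (0, 0)) => k; last first.
    by move=> le_wk; rewrite insubF // ltnNge le_wk.
  case: insubP => [i _ <- | ]; first exact: Hgq.
  rewrite -leqNgt => /(nth_default 0)->; split=> //=.
  by rewrite (_ : 0^`() = 0) ?mul0r ?mulr0 ?subr0 ?mul0r ?addr0 // -polyC0 derivC.
pose a := \poly_(k < size w) ((G k).1 * h ^+ k) : {poly {poly F}}.
(* A y-antiderivative of the second components. Where p | k the inverse is 0 by convention, which is
   harmless: for k > 0 the component is 0 there, and the constant term is killed by d/dy. *)
pose b := \poly_(k < (size w).+1) (k%:R^-1 *: (G k.-1).2 * h ^+ k) : {poly {poly F}}.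
have Ea k : a`_k = (G k).1 * h ^+ k.
  by rewrite coef_poly; case: ltnP => // /G0->; rewrite mul0r.
have Eb k : b`_k.+1 = k.+1%:R^-1 *: (G k).2 * h ^+ k.+1.
  by rewrite coef_poly ltnS; case: ltnP => // /G0->; rewrite scaler0 mul0r.
have Aa : in_A h a by apply/inAP => k; rewrite Ea dvdp_mull.
have Ab : in_A h b.
  by apply/inAP => -[|k]; [rewrite expr0 dvd1p | rewrite Eb dvdp_mull].
(* Subtracting [e] cancels the y-derivative by which D_2 differs from [D2_main]. *)
have [e Ae ED] := D2_mod_deriv Aa; exists a, (b - e); split=> //.
split; first exact: inA_B.
rewrite ED subrK; apply/polyP=> k; rewrite coefD coef_deriv (coef_D2_main (Ea k)) Eb.
have [G2 ->] := HG k; congr (_ + _); rewrite -mulrnAl; congr (_ * _).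
rewrite -scaler_nat scalerA; have [/G2-> | npk] := boolP (p %| k.+1)%N.
  by rewrite scaler0.
by rewrite divff ?scale1r // -(dvdn_pcharf pcharF).
Qed.

End Image.

(** * 2-cocycles on A and their deviation from the defining relation *)

Section Cochains.
Set Implicit Arguments. Unset Strict Implicit.
Variables (F : fieldType) (h : {poly F}).
Local Notation WF := {poly {poly F}}.
Implicit Types (g : {poly F}) (a b c w z : WF) (f : WF -> WF -> WF) (t : WF -> WF).

Lemma hy0 : hy h 0 = 1.
Proof. by rewrite /hy expr0 mulr1. Qed.

Lemma Zhy_monomial g j : g *: hy h j = (g * h ^+ j) *: 'X^j.
Proof. by rewrite /hy mul_polyC scalerA. Qed.

Lemma yhat_hy0 : wmul (yhat h) (hy h 0) = yhat h.
Proof. by rewrite hy0 wmul1r. Qed.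

Lemma wmul_yhatZ g w :
  wmul (yhat h) (g *: w) = g *: wmul (yhat h) w + (g^`() * h) *: w.
Proof. by rewrite !wmul_yhat LyZ -!mul_polyC polyCM; ring. Qed.

Lemma yhat_wpol g :
  wmul (yhat h) (wpol g) = wmul (wpol g) (yhat h) + wpol (g^`() * h).
Proof.
have E k : wpol k = k *: 1 by rewrite /wpol -mul_polyC mulr1.
by rewrite [in LHS]E wmul_yhatZ wmul1r -E wmulPl.
Qed.

Lemma yhat_wx : wmul (yhat h) (wx F) = wmul (wx F) (yhat h) + wpol h.
Proof. by rewrite yhat_wpol derivX mul1r. Qed.

(** Cochains are functions on all of the Weyl algebra that are constrained on A only, so linearity
    is stated relative to A. *)
Definition linearA t := forall (x : F) a b, in_A h a -> in_A h b ->
  t (wsc x a + b) = wsc x (t a) + t b.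

Section LinearA.
Variable t : WF -> WF.
Hypothesis t_linear : linearA t.

Lemma linA_D a b : in_A h a -> in_A h b -> t (a + b) = t a + t b.
Proof. by move=> Aa Ab; have := t_linear 1 Aa Ab; rewrite /wsc !scale1r. Qed.

Lemma linA_0 : t 0 = 0.
Proof.
by apply: (@addrI _ (t 0)); rewrite -linA_D ?addr0 //; apply: inA0.
Qed.

Lemma linA_Z x a : in_A h a -> t (x%:P *: a) = x%:P *: t a.
Proof.
by move=> Aa; have := t_linear x Aa (inA0 h); rewrite /wsc linA_0 !addr0.
Qed.

Lemma linA_poly g :
  t (wpol g) = \sum_(s < size g) (g`_s)%:P *: t (wpol 'X^s).
Proof.
rewrite -{1}[g]coefK poly_def /wpol rmorph_sum /=.
rewrite -(big_mkord xpredT (fun i => (g`_i *: 'X^i)%:P)).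
rewrite -(big_mkord xpredT (fun i => (g`_i)%:P *: t ('X^i)%:P)).
elim: (size g) => [|n IH]; first by rewrite !big_nil linA_0.
rewrite !big_nat_recr //= -IH -mul_polyC polyCM mul_polyC -linA_Z; last exact: inA_wpol.
rewrite linA_D //; last exact/inA_Z/inA_wpol.
by rewrite -rmorph_sum; apply: inA_wpol.
Qed.

End LinearA.

Definition deriv_cochain t a b := wmul a (t b) - t (wmul a b) + wmul (t a) b.

Section Cocycle.
Variable f : WF -> WF -> WF.
Hypothesis f_cocycle : cocycle2 h f.

Lemma cocycle_inA a b : in_A h a -> in_A h b -> in_A h (f a b).
Proof. by case: f_cocycle => -[fA _] _; apply: fA. Qed.

Lemma cocycle_linl b : in_A h b -> linearA (f^~ b).
Proof. by case: f_cocycle => -[_ [fl _]] _ Ab x a a' Aa Aa'; apply: fl. Qed.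

Lemma cocycle_linr a : in_A h a -> linearA (f a).
Proof. by case: f_cocycle => -[_ [_ fr]] _ Aa x b b' Ab Ab'; apply: fr. Qed.

Lemma cocycle_mul a b c : in_A h a -> in_A h b -> in_A h c ->
  f (wmul a b) c = wmul a (f b c) + f a (wmul b c) - wmul (f a b) c.
Proof.
case: f_cocycle => _ fE Aa Ab Ac; apply/esym/eqP; rewrite -subr_eq0; apply/eqP.
by rewrite -(fE _ _ _ Aa Ab Ac) -[LHS]/(_ + _ - _ - _ : WF); ring.
Qed.

Lemma cocycle_1l c : in_A h c -> f 1 c = wmul (f 1 1) c.
Proof.
move=> Ac; have := cocycle_mul (inA_one h) (inA_one h) Ac.
rewrite !wmul1l => /eqP; rewrite -subr_eq0 => /eqP E.
by apply: subr0_eq; rewrite -[RHS]oppr0 -E; ring.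
Qed.

Lemma cocycle_1r a : in_A h a -> f a 1 = wmul a (f 1 1).
Proof.
move=> Aa; have := cocycle_mul Aa (inA_one h) (inA_one h).
by rewrite !wmul1r => ->; ring.
Qed.

(** Vanishing spreads by the cocycle identity: first to f(x, -), then to f(g, -) for g in F[x], to
    f(yhat, g), to f(yhat, -), and finally to all of A by generation. The last hypothesis is the one
    tied to the relation between x and [yhat]. *)
Lemma cocycle_eq0 : f 1 1 = 0 -> (forall s, f (wx F) (wpol 'X^s) = 0) ->
  (forall g j, f (wpol g) (hy h j) = 0) -> (forall j, f (yhat h) (hy h j) = 0) ->
  f (yhat h) (wx F) = f (wx F) (yhat h) ->
  forall a b, in_A h a -> in_A h b -> f a b = 0.
Proof.
move=> f11 fxX fPe fye fyx.
have Ax := inA_x h; have Ay := inA_yhat h; have AP := inA_wpol h; have Ae := inA_hy h.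
have f1 b : in_A h b -> f 1 b = 0 by move=> Ab; rewrite cocycle_1l // f11 wmul0l.
have fxP g : f (wx F) (wpol g) = 0.
  rewrite (linA_poly (cocycle_linr Ax)) big1 // => s _.
  by rewrite fxX scaler0.
have fx b : in_A h b -> f (wx F) b = 0.
  elim/inA_ind_hy: b / => [g j | a b Aa Ab fa fb].
    have := cocycle_mul Ax (AP g) (Ae j); rewrite fxP wmul0l subr0 fPe wmul0r add0r.
    rewrite [wmul (wpol g) _]wmulPl => <-.
    by rewrite wmulPl /wpol -mul_polyC -polyCM fPe.
  by rewrite (linA_D (cocycle_linr Ax)) // fa fb addr0.
have fP g b : in_A h b -> f (wpol g) b = 0.
  move=> Ab; elim/poly_ind: g => [|g x IH]; first exact: (linA_0 (cocycle_linl Ab)).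
  rewrite /wpol polyCD polyCM -[x%:P%:P]mulr1 [g%:P * _]mulrC !mul_polyC.
  rewrite (linA_D (cocycle_linl Ab)); [|exact/inA_Z/AP|exact/inA_Z/inA_one].
  rewrite (linA_Z (cocycle_linl Ab) x (inA_one h)) f1 // scaler0 addr0.
  rewrite -wmulPl (cocycle_mul Ax (AP g) Ab) IH !fx //; last exact: inA_mul.
  by rewrite wmul0l wmul0r subr0 addr0.
have fyX : f (yhat h) (wx F) = 0 by rewrite fyx fx.
have fyP g : f (yhat h) (wpol g) = 0.
  elim/poly_ind: g => [|g x IH]; first exact: (linA_0 (cocycle_linr Ay)).
  rewrite /wpol polyCD polyCM -[x%:P%:P]mulr1 [g%:P * _]mulrC !mul_polyC.
  rewrite (linA_D (cocycle_linr Ay)); [|exact/inA_Z/AP|exact/inA_Z/inA_one].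
  rewrite (linA_Z (cocycle_linr Ay)); last exact: inA_one.
  rewrite [X in _ + _ *: X]cocycle_1r // f11 wmul0r scaler0 addr0 -wmulPl.
  (* The identity turns f(yhat, x g) into f(yhat x, g); writing yhat x = x yhat + h reduces this to
     f(yhat, g) and to values already known to vanish. *)
  have := cocycle_mul Ay Ax (AP g); rewrite fx // wmul0r add0r fyX wmul0l subr0 => <-.
  rewrite yhat_wx.
  rewrite (linA_D (cocycle_linl (AP g))) //; last exact: inA_mul.
  by rewrite [X in _ + X]fP // addr0 cocycle_mul // IH wmul0r add0r !fx ?wmul0l ?subrr //;
     apply: inA_mul.
have fy b : in_A h b -> f (yhat h) b = 0.
  elim/inA_ind_hy: b / => [g j | a b Aa Ab fa fb].
    have := cocycle_mul Ay (AP g) (Ae j); rewrite fP // wmul0r add0r fyP wmul0l subr0.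
    rewrite [wmul (wpol g) _]wmulPl => <-.
    rewrite yhat_wpol.
    rewrite (linA_D (cocycle_linl (Ae j))) //; last exact: inA_mul.
    rewrite [X in _ + X]fP // addr0 cocycle_mul // fye wmul0r add0r !fP ?wmul0l ?subrr //.
    exact: inA_mul.
  by rewrite (linA_D (cocycle_linr Ay)) // fa fb addr0.
move=> a b Aa; elim: Aa b => [|||x a' Aa' IH|a1 a2 A1 IH1 A2 IH2|a1 a2 A1 IH1 A2 IH2] b Ab.
- exact: f1.
- exact: fx.
- exact: fy.
- by rewrite (linA_Z (cocycle_linl Ab)) // IH // scaler0.
- by rewrite (linA_D (cocycle_linl Ab)) // IH1 // IH2 // addr0.
rewrite cocycle_mul // IH2 // !IH1 // ?wmul0l ?wmul0r ?subrr ?addr0 ?subr0 //.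
exact: inA_mul.
Qed.

End Cocycle.

(* In the square-zero extension of A by A with cocycle f, lift x and yhat to
   X = (x, 0) and Y = (yhat, 0): X^s has second component [lift_pow f s], and
   YX - XY - h(X) has second component [deviation f]; (1, - f 1 1) is the unit. *)
Fixpoint lift_pow f s : WF :=
  if s is s'.+1 then wmul (wx F) (lift_pow f s') + f (wx F) (wpol 'X^s')
  else - f 1 1.

Definition deviation f : WF :=
  f (yhat h) (wx F) - f (wx F) (yhat h) -
  \sum_(s < size h) wsc h`_s (lift_pow f s).

Lemma lift_powD f1 f2 s :
  lift_pow (fun a b => f1 a b + f2 a b) s = lift_pow f1 s + lift_pow f2 s.
Proof. by elim: s => [|s /= ->]; rewrite /= ?wmulDr; ring. Qed.

Lemma deviationD f1 f2 :
  deviation (fun a b => f1 a b + f2 a b) = deviation f1 + deviation f2.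
Proof.
rewrite /deviation; under eq_bigr do rewrite lift_powD /wsc scalerDr.
by rewrite big_split /=; ring.
Qed.

Lemma lift_powZ z f s : in_ZA h z ->
  lift_pow (fun a b => wmul z (f a b)) s = wmul z (lift_pow f s).
Proof.
move=> [Az Cz]; elim: s => [|s /= ->]; first by rewrite /= wmulNr.
by rewrite wmulDr !wmulA [wmul z (wx F)]Cz //; apply: inA_x.
Qed.

Lemma deviationZ z f : in_ZA h z ->
  deviation (fun a b => wmul z (f a b)) = wmul z (deviation f).
Proof.
move=> Zz; rewrite /deviation; under eq_bigr do rewrite lift_powZ // /wsc -wmulCr.
by rewrite -wmul_sumr -!wmulBr.
Qed.

Lemma inA_lift_pow f s : cocycle2 h f -> in_A h (lift_pow f s).
Proof.
move=> fC; elim: s => [|s IH] /=.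
  by apply/inA_N/(cocycle_inA fC); apply: inA_one.
apply: inA_add; first by apply: inA_mul IH; apply: inA_x.
by apply: (cocycle_inA fC); [apply: inA_x | apply: inA_wpol].
Qed.

Lemma inA_deviation f : cocycle2 h f -> in_A h (deviation f).
Proof.
move=> fC; have Ax := inA_x h; have Ay := inA_yhat h.
apply: inA_B; first by apply: inA_B; apply: (cocycle_inA fC).
by apply: inA_sum => s _; apply/inA_scale/inA_lift_pow.
Qed.

Lemma lift_pow_normalized f s : f 1 1 = 0 ->
  (forall n, f (wx F) (wpol 'X^n) = 0) -> lift_pow f s = 0.
Proof. by move=> f11 fx; elim: s => [|s /= ->]; rewrite /= ?f11 ?oppr0 // fx wmul0r addr0. Qed.

Lemma deviation_normalized f : f 1 1 = 0 ->
  (forall n, f (wx F) (wpol 'X^n) = 0) ->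
  deviation f = f (yhat h) (wx F) - f (wx F) (yhat h).
Proof.
move=> f11 fx; rewrite /deviation big1 ?subr0 // => s _.
by rewrite lift_pow_normalized // /wsc scaler0.
Qed.

(** For f = dt the map a -> (a, -t(a)) splits the extension, and X, Y exceed the images of x, [yhat]
    by t(x), t(yhat). The auxiliary [r s] is the excess of X^s over the image of x^s, namely
    F_(t(x))(x^s). *)
Lemma deviation_coboundary f t :
  (forall a b, in_A h a -> in_A h b -> f a b = deriv_cochain t a b) -> linearA t ->
  deviation f = D2 h (t (wx F)) (t (yhat h)).
Proof.
move=> fE tL; have Ax := inA_x h; have Ay := inA_yhat h; have A1 := inA_one h.
pose r s : WF := lift_pow f s + t (wpol 'X^s).
have rE s : r s = \sum_(l < s) wmul (wpol 'X^l) (wmul (t (wx F)) (wpol 'X^(s - l - 1))).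
  elim: s => [|s IH].
    by rewrite big_ord0 /r /= fE // /deriv_cochain !wmul1l wmul1r; ring.
  rewrite big_ord_recl wmulPl scale1r subn0 subn1 /=.
  transitivity (wmul (t (wx F)) (wpol 'X^s) + wmul (wx F) (r s)).
    rewrite /r /= (fE _ _ Ax (inA_wpol h _)) /deriv_cochain wmulDr.
    rewrite [wmul (wx F) (wpol _)]wmulPl.
    by rewrite /wpol -mul_polyC -polyCM -exprS; ring.
  rewrite IH; congr (_ + _); rewrite wmulPl scaler_sumr; apply: eq_bigr => l _.
  by rewrite !wmulPl scalerA -exprS subSS.
rewrite /deviation /D2 /Fmap /wcomm !fE // /deriv_cochain yhat_wx.
rewrite (linA_D tL (inA_mul Ax Ay) (inA_wpol h h)) (linA_poly tL).
under [X in _ = _ - X]eq_bigr do rewrite -rE /r /wsc scalerDr.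
by rewrite big_split /=; ring.
Qed.

Lemma deriv_cochain_cocycle t a b c :
  wmul a (deriv_cochain t b c) - deriv_cochain t (wmul a b) c
  + deriv_cochain t a (wmul b c) - wmul (deriv_cochain t a b) c = 0.
Proof. by rewrite /deriv_cochain !(wmulDl, wmulDr, wmulNl, wmulNr) !wmulA; ring. Qed.

Lemma cocycle_sub_coboundary f t : cocycle2 h f ->
  (forall a, in_A h a -> in_A h (t a)) -> linearA t ->
  cocycle2 h (fun a b => f a b - deriv_cochain t a b).
Proof.
move=> fC tA tL; split; last first.
  move=> a b c Aa Ab Ac; rewrite (cocycle_mul fC) // -[RHS]oppr0.
  by rewrite -[in RHS](deriv_cochain_cocycle t a b c) !(wmulDl, wmulDr, wmulNl, wmulNr); ring.
split=> [a b Aa Ab|].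
  apply: inA_B; first exact: (cocycle_inA fC).
  by apply: inA_add; [apply: inA_B|]; [|apply: tA|]; apply: inA_mul => //; apply: tA.
split=> x a b c Aa Ab Ac; rewrite /deriv_cochain /wsc.
  rewrite (cocycle_linl fC Ac x Aa Ab) !(wmulDl, wmulZl) !(tL x) //; try exact: inA_mul.
  by rewrite /wsc !(wmulDl, wmulZl) -!mul_polyC; ring.
rewrite (cocycle_linr fC Aa x Ab Ac) !(wmulDr, wmulCr) !(tL x) //; try exact: inA_mul.
by rewrite /wsc !(wmulDr, wmulCr) -!mul_polyC; ring.
Qed.

End Cochains.

(** * A cocycle whose deviation lies in the image of D_2 is a coboundary *)

Section Trivialization.
Set Implicit Arguments. Unset Strict Implicit.
Variables (F : fieldType) (h : {poly F}).
Hypothesis h0 : h != 0.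
Local Notation WF := {poly {poly F}}.
Variables (f : WF -> WF -> WF) (al be : WF).
Hypotheses (f_cocycle : cocycle2 h f) (Aal : in_A h al) (Abe : in_A h be).
Implicit Types (g : {poly F}) (a b c w : WF).

(* [triv] is the A-component of the algebra map from A to the square-zero
   extension with cocycle f sending x to (x, al) and yhat to (yhat, be); it is
   computed on the basis of powers of x, then on the left F[x]-basis h^j y^j. *)
Fixpoint triv_pow s : WF :=
  if s is s'.+1 then
    wmul (wx F) (triv_pow s') + wmul al (wpol 'X^s') - f (wx F) (wpol 'X^s')
  else f 1 1.

Definition triv_pol : {poly F} -> WF := coefsum (fun s x => wsc x (triv_pow s)).

(** A cochain t with dt = f satisfies t(ab) = a t(b) + t(a) b - f(a, b); this is the value so forced
    at g h^j y^j when t(h^j y^j) is [u]. *)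
Definition triv_term u g j : WF := g *: u + wmul (triv_pol g) (hy h j) - f (wpol g) (hy h j).

(** The value forced at yhat h^j y^j, less the one at (j+1) h' h^j y^j, in accordance with
    [yhat_hy]. The starting value is forced by 1 = 1 1. *)
Fixpoint triv_hy j : WF :=
  if j is j'.+1 then
    wmul (yhat h) (triv_hy j') + wmul be (hy h j') - f (yhat h) (hy h j')
    - triv_term (triv_hy j') (j'.+1%:R * h^`()) j'
  else f 1 1.

Definition triv : WF -> WF :=
  coefsum (fun j g => triv_term (triv_hy j) (g %/ h ^+ j) j).

Let Ax := inA_x h.
Let Ay := inA_yhat h.
Let A1 := inA_one h.
Let Ae := inA_hy h.
Let AP := inA_wpol h.
Let fA := cocycle_inA f_cocycle.

Lemma triv_pol_additive s (x y : F) :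
  wsc (x + y) (triv_pow s) = wsc x (triv_pow s) + wsc y (triv_pow s).
Proof. by rewrite /wsc polyCD scalerDl. Qed.

Lemma triv_polD g1 g2 : triv_pol (g1 + g2) = triv_pol g1 + triv_pol g2.
Proof. exact: coefsumD triv_pol_additive _ _. Qed.

Lemma triv_polZ (x : F) g : triv_pol (x *: g) = x%:P *: triv_pol g.
Proof.
rewrite [LHS](coefsum_widen triv_pol_additive (size_scale_leq x g)).
rewrite scaler_sumr; apply: eq_bigr => s _.
by rewrite coefZ /wsc polyCM scalerA.
Qed.

Lemma triv_polXn s : triv_pol 'X^s = triv_pow s.
Proof.
rewrite -['X^s]scale1r [LHS](coefsum_monomial triv_pol_additive).
by rewrite /wsc scale1r.
Qed.

Lemma triv_termD u g1 g2 j :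
  triv_term u (g1 + g2) j = triv_term u g1 j + triv_term u g2 j.
Proof.
rewrite /triv_term scalerDl triv_polD wmulDl /wpol polyCD.
by rewrite (linA_D (cocycle_linl f_cocycle (Ae j)) (AP g1) (AP g2)); ring.
Qed.

Lemma triv_termZ u x g j : triv_term u (x *: g) j = x%:P *: triv_term u g j.
Proof.
rewrite /triv_term triv_polZ wmulZl.
have -> : wpol (x *: g) = x%:P *: wpol g by rewrite /wpol -!mul_polyC polyCM.
rewrite (linA_Z (cocycle_linl f_cocycle (Ae j)) x (AP g)).
by rewrite -mul_polyC -scalerA !scalerDr scalerN.
Qed.

Lemma triv_additive j g1 g2 :
  triv_term (triv_hy j) ((g1 + g2) %/ h ^+ j) j =
  triv_term (triv_hy j) (g1 %/ h ^+ j) j + triv_term (triv_hy j) (g2 %/ h ^+ j) j.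
Proof. by rewrite divpD triv_termD. Qed.

Lemma trivD a b : triv (a + b) = triv a + triv b.
Proof. exact: coefsumD triv_additive _ _. Qed.

Lemma triv_linear : linearA h triv.
Proof.
move=> x a b _ _; rewrite trivD; congr (_ + _).
rewrite /wsc [LHS](coefsum_widen triv_additive (size_scale_leq x%:P a)).
rewrite scaler_sumr; apply: eq_bigr => j _.
by rewrite coefZ mul_polyC divpZl triv_termZ.
Qed.

Lemma triv_Zhy g j : triv (g *: hy h j) = triv_term (triv_hy j) g j.
Proof.
rewrite Zhy_monomial [LHS](coefsum_monomial triv_additive).
by rewrite mulpK ?expf_neq0.
Qed.

Lemma triv_pol1 : triv_pol 1 = f 1 1.
Proof. exact: (triv_polXn 0). Qed.

Lemma triv_hyE j : triv (hy h j) = triv_hy j.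
Proof.
rewrite -[hy h j]scale1r triv_Zhy /triv_term scale1r triv_pol1.
by rewrite (cocycle_1l f_cocycle (Ae j)) addrK.
Qed.

Lemma triv_wpol g : triv (wpol g) = triv_pol g.
Proof.
have {1}-> : wpol g = g *: hy h 0 by rewrite hy0 /wpol -mul_polyC mulr1.
rewrite triv_Zhy /triv_term hy0 (cocycle_1r f_cocycle (AP g)) wmulPl wmul1r /=.
by rewrite addrC addKr.
Qed.

Lemma triv1 : triv 1 = f 1 1.
Proof. by rewrite -(hy0 h) triv_hyE hy0. Qed.

Lemma triv_wx : triv (wx F) = al.
Proof.
rewrite triv_wpol -['X]expr1 triv_polXn /= expr0 wmul1r.
by rewrite (cocycle_1r f_cocycle Ax) addrAC subrr add0r.
Qed.

Lemma triv_yhat_hy j : triv (wmul (yhat h) (hy h j)) =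
  wmul (yhat h) (triv_hy j) + wmul be (hy h j) - f (yhat h) (hy h j).
Proof. by rewrite yhat_hy trivD triv_hyE triv_Zhy /= subrK. Qed.

Lemma triv_yhat : triv (yhat h) = be.
Proof.
rewrite -{1}(yhat_hy0 h) triv_yhat_hy hy0 /= (cocycle_1r f_cocycle Ay) wmul1r.
by rewrite addrAC subrr add0r.
Qed.

Lemma inA_triv a : in_A h a -> in_A h (triv a).
Proof.
have A_pow s : in_A h (triv_pow s).
  elim: s => [|s IH] /=; first exact: fA.
  by apply: inA_B; [apply: inA_add; apply: inA_mul | apply: fA].
have A_pol g : in_A h (triv_pol g) by apply: inA_sum => s _; apply: inA_scale.
have A_term u g j : in_A h u -> in_A h (triv_term u g j).
  move=> Au; apply: inA_B; last exact: fA.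
  by apply: inA_add; [apply: inA_Z | apply: inA_mul].
have A_hy j : in_A h (triv_hy j).
  elim: j => [|j IH] /=; first exact: fA.
  apply: inA_B; last exact: A_term.
  by apply: inA_B; [apply: inA_add; apply: inA_mul | apply: fA].
by move=> _; apply: inA_sum => j _; apply: A_term.
Qed.

(** By construction of [triv], the difference of f and d(triv) meets every hypothesis of
    [cocycle_eq0] but the last; that one says that its deviation vanishes. *)
Lemma coboundary_of_deviation : deviation h f = D2 h al be -> coboundary2 h f.
Proof.
move=> dev_f; have f'_cocycle := cocycle_sub_coboundary f_cocycle inA_triv triv_linear.
exists triv; split; first exact: inA_triv.
split; first exact: triv_linear.
move=> a b Aa Ab; apply: subr0_eq; move: a b Aa Ab.
have f'11 : f 1 1 - deriv_cochain triv 1 1 = 0.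
  by rewrite /deriv_cochain !wmul1r wmul1l triv1; ring.
have f'x s : f (wx F) (wpol 'X^s) - deriv_cochain triv (wx F) (wpol 'X^s) = 0.
  rewrite /deriv_cochain triv_wx.
  have -> : wmul (wx F) (wpol 'X^s) = wpol 'X^(s.+1).
    by rewrite wmulPl /wpol -mul_polyC -polyCM -exprS.
  by rewrite !triv_wpol !triv_polXn /=; ring.
apply: (cocycle_eq0 f'_cocycle f'11 f'x) => [g j | j |].
- by rewrite /deriv_cochain triv_wpol triv_hyE !wmulPl triv_Zhy /triv_term; ring.
- by rewrite /deriv_cochain triv_yhat triv_hyE triv_yhat_hy; ring.
pose f' a b : WF := f a b - deriv_cochain triv a b.
suff dev_f' : deviation h f' = 0.
  by apply: subr0_eq; rewrite -[RHS]dev_f' (@deviation_normalized _ h f').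
have := deviationD h f' (deriv_cochain triv).
have -> : deviation h (deriv_cochain triv) = D2 h al be.
  by rewrite (deviation_coboundary _ triv_linear) // triv_wx triv_yhat.
(* The sum of [f'] and d(triv) agrees with f pointwise, so the two deviations are compared term by
   term. *)
rewrite -dev_f => E; apply: (@addIr _ (deviation h f)); rewrite add0r -E.
rewrite /deviation /f' !subrK; congr (_ - _); apply: eq_bigr => s _; congr (wsc _ _).
by elim: (nat_of_ord s) => [|n IH] /=; rewrite ?IH subrK.
Qed.

End Trivialization.

(** * Every element of A is the deviation of a cocycle *)

Section DeviationCocycle.
Set Implicit Arguments. Unset Strict Implicit.
Variables (F : fieldType) (h : {poly F}).
Hypothesis h0 : h != 0.
Local Notation WF := {poly {poly F}}.
Variable m : WF.
Hypothesis Am : in_A h m.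
Implicit Types (g : {poly F}) (a b c w : WF).

(* [ore_cocycle] is the cocycle of the square-zero extension of A by A generated
   by x and Y with Yx - xY = h + m; [ore_yhat] is its value at (yhat, -). *)
Definition ore_yhat : WF -> WF :=
  coefsum (fun j g => wmul (Fmap m (g %/ h ^+ j)) (hy h j)).

(** The value at (h^j y^j, c), forced by [yhat_hy] and the cocycle identity when the cocycle
    vanishes at (g, -) for g in F[x] and at (yhat, h^j y^j). *)
Fixpoint ore_hy j c : WF :=
  if j is j'.+1 then
    wmul (yhat h) (ore_hy j' c) + ore_yhat (wmul (hy h j') c)
    - (j'.+1%:R * h^`()) *: ore_hy j' c
  else 0.

Definition ore_cocycle a c : WF :=
  coefsum (fun j g => (g %/ h ^+ j) *: ore_hy j c) a.

Lemma ore_yhat_additive j g1 g2 :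
  wmul (Fmap m ((g1 + g2) %/ h ^+ j)) (hy h j) =
  wmul (Fmap m (g1 %/ h ^+ j)) (hy h j) + wmul (Fmap m (g2 %/ h ^+ j)) (hy h j).
Proof. by rewrite divpD FmapD wmulDl. Qed.

Lemma ore_yhatD a b : ore_yhat (a + b) = ore_yhat a + ore_yhat b.
Proof. exact: coefsumD ore_yhat_additive _ _. Qed.

Lemma ore_yhatC (x : F) a : ore_yhat (x%:P *: a) = x%:P *: ore_yhat a.
Proof.
rewrite [LHS](coefsum_widen ore_yhat_additive (size_scale_leq x%:P a)).
rewrite scaler_sumr; apply: eq_bigr => j _.
by rewrite coefZ mul_polyC divpZl FmapZ wmulZl.
Qed.

Lemma ore_yhat_Zhy g j : ore_yhat (g *: hy h j) = wmul (Fmap m g) (hy h j).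
Proof.
rewrite Zhy_monomial [LHS](coefsum_monomial ore_yhat_additive).
by rewrite mulpK ?expf_neq0.
Qed.

(** Comes from the Leibniz rule of F_m, and reflects that [Y, g(x)] has second component F_m(g) in
    the extension. *)
Lemma ore_yhatZ g b : in_A h b ->
  ore_yhat (g *: b) = g *: ore_yhat b + wmul (Fmap m g) b.
Proof.
elim/inA_ind_hy: b / => [k j | a b _ _ IHa IHb].
  by rewrite scalerA !ore_yhat_Zhy Fmap_Leibniz wmulDl wmulZl -wmulA wmulPl.
by rewrite scalerDr !ore_yhatD IHa IHb wmulDr scalerDr; ring.
Qed.

Lemma inA_ore_yhat a : in_A h (ore_yhat a).
Proof.
by apply: inA_sum => j _; apply: inA_mul; [apply: inA_Fmap | apply: inA_hy].
Qed.

Lemma ore_hy_linear j x a b : ore_hy j (x%:P *: a + b) = x%:P *: ore_hy j a + ore_hy j b.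
Proof.
elim: j => [|j IH] /=; first by rewrite scaler0 addr0.
rewrite IH !wmulDr ore_yhatD !wmulCr ore_yhatC.
by rewrite -!mul_polyC; ring.
Qed.

Lemma inA_ore_hy j c : in_A h c -> in_A h (ore_hy j c).
Proof.
move=> Ac; elim: j => [|j IH] /=; first exact: inA0.
apply: inA_B; last exact: inA_Z.
by apply: inA_add; [apply: inA_mul IH; apply: inA_yhat | apply: inA_ore_yhat].
Qed.

Lemma ore_additive c j g1 g2 :
  ((g1 + g2) %/ h ^+ j) *: ore_hy j c =
  (g1 %/ h ^+ j) *: ore_hy j c + (g2 %/ h ^+ j) *: ore_hy j c.
Proof. by rewrite divpD scalerDl. Qed.

Lemma oreDl a b c : ore_cocycle (a + b) c = ore_cocycle a c + ore_cocycle b c.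
Proof. exact: coefsumD (ore_additive c) _ _. Qed.

Lemma ore_Zhy g j c : ore_cocycle (g *: hy h j) c = g *: ore_hy j c.
Proof.
rewrite Zhy_monomial [LHS](coefsum_monomial (ore_additive c)).
by rewrite mulpK ?expf_neq0.
Qed.

Lemma oreZl g b c : in_A h b -> ore_cocycle (g *: b) c = g *: ore_cocycle b c.
Proof.
elim/inA_ind_hy: b / => [k j | a b _ _ IHa IHb].
  by rewrite scalerA !ore_Zhy scalerA.
by rewrite scalerDr !oreDl IHa IHb scalerDr.
Qed.

Lemma ore_linear_r x a b c :
  ore_cocycle a (x%:P *: b + c) = x%:P *: ore_cocycle a b + ore_cocycle a c.
Proof.
rewrite /ore_cocycle /coefsum scaler_sumr -big_split; apply: eq_bigr => j _ /=.
by rewrite ore_hy_linear scalerDr !scalerA mulrC.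
Qed.

Lemma inA_ore a c : in_A h c -> in_A h (ore_cocycle a c).
Proof. by move=> Ac; apply: inA_sum => j _; apply/inA_Z/inA_ore_hy. Qed.

Lemma ore_1l c : ore_cocycle 1 c = 0.
Proof. by rewrite -(hy0 h) -[hy h 0]scale1r ore_Zhy scaler0. Qed.

Lemma ore_wpol_l g c : ore_cocycle (wpol g) c = 0.
Proof.
have -> : wpol g = g *: 1 by rewrite /wpol -mul_polyC mulr1.
by rewrite oreZl ?ore_1l ?scaler0 //; apply: inA_one.
Qed.

(** The cocycle identity for first argument [yhat], the one generator where it is not immediate; on
    basis elements it unfolds the recursion [ore_hy]. *)
Lemma ore_yhat_l b c : in_A h b -> in_A h c ->
  ore_cocycle (wmul (yhat h) b) c =
  wmul (yhat h) (ore_cocycle b c) + ore_yhat (wmul b c) - wmul (ore_yhat b) c.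
Proof.
move=> Ab Ac; elim/inA_ind_hy: b / Ab => [g j | a b _ _ IHa IHb]; last first.
  by rewrite wmulDr !oreDl IHa IHb !(wmulDl, wmulDr) !ore_yhatD wmulDl; ring.
rewrite wmul_yhatZ yhat_hy scalerDr scalerA !oreDl !ore_Zhy wmulZl.
rewrite ore_yhatZ ?ore_yhat_Zhy; last exact: inA_mul (inA_hy h j) Ac.
rewrite wmul_yhatZ /= wmulA -!mul_polyC !polyCM.
by ring.
Qed.

Lemma ore_yhatE c : in_A h c -> ore_cocycle (yhat h) c = ore_yhat c.
Proof.
move=> Ac; rewrite -[yhat h]wmul1r ore_yhat_l ?inA_one //; last exact: inA_one.
rewrite ore_1l wmul0r add0r wmul1l -[X in wmul (ore_yhat X) _](hy0 h).
by rewrite -[hy h 0]scale1r ore_yhat_Zhy FmapC !wmul0l subr0.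
Qed.

Lemma ore_is_cocycle : cocycle2 h ore_cocycle.
Proof.
have Ax := inA_x h; have Ay := inA_yhat h.
split.
  split; first by move=> a b _; apply: inA_ore.
  split=> [x a b c Aa Ab Ac | x a b c _ _ _]; last exact: ore_linear_r.
  by rewrite oreDl /wsc oreZl.
move=> a b c Aa; elim: Aa b c =>
  [|||x a' Aa' IH|a1 a2 A1 IH1 A2 IH2|a1 a2 A1 IH1 A2 IH2] b c Ab Ac.
- by rewrite !wmul1l !ore_1l wmul0l; ring.
- by rewrite !ore_wpol_l wmul0l !wmulPl oreZl //; ring.
- rewrite ore_yhat_l // !ore_yhatE //; last exact: inA_mul.
  by ring.
- rewrite /wsc !wmulZl !oreZl //; last exact: inA_mul.
  by rewrite wmulZl -!scalerBr -scalerDr -scalerBr IH // scaler0.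
- rewrite !(wmulDl, oreDl) -[RHS]addr0.
  rewrite -[X in _ = X + _](IH1 b c) // -[X in _ = _ + X](IH2 b c) //.
  by ring.
(* Since the Hochschild differential squares to zero, the identity at (a1 a2, b, c) is an
   alternating sum of four instances whose first argument is a1 or a2. *)
have := congr1 (wmul a1) (IH2 b c Ab Ac).
have := IH1 (wmul a2 b) c (inA_mul A2 Ab) Ac.
have := IH1 a2 (wmul b c) A2 (inA_mul Ab Ac).
have := congr1 (fun u => wmul u c) (IH1 a2 b A2 Ab).
rewrite wmul0l wmul0r !(wmulDl, wmulDr, wmulNl, wmulNr) !wmulA => E1 E2 E3 E4.
have comb (e1 e2 e3 e4 : WF) :
    e1 = 0 -> e2 = 0 -> e3 = 0 -> e4 = 0 -> e4 + e3 - e2 + e1 = 0.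
  by move=> -> -> -> ->; ring.
by rewrite -[RHS](comb _ _ _ _ E1 E2 E3 E4); ring.
Qed.

Lemma deviation_ore : deviation h ore_cocycle = m.
Proof.
rewrite deviation_normalized ?ore_1l // => [|n]; last exact: ore_wpol_l.
rewrite ore_wpol_l subr0 ore_yhatE; last exact: inA_x.
have -> : wx F = 'X *: hy h 0 by rewrite hy0 /wx /wpol -mul_polyC mulr1.
by rewrite ore_yhat_Zhy FmapX hy0 wmul1r.
Qed.

End DeviationCocycle.

(** * Decomposition of the image, and the second cohomology *)

Section SecondCohomology.
Set Implicit Arguments. Unset Strict Implicit.
Variables (F : fieldType) (p : nat) (h : {poly F}).
Hypotheses (pcharF : p \in [pchar F]) (h0 : h != 0).
Local Notation WF := {poly {poly F}}.
Implicit Types (g : {poly F}) (c u v w z : WF) (f : WF -> WF -> WF).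

Let Ep : p.-1.+1 = p := prednK (p_gt0 pcharF).

Lemma sum_ord_p (G : nat -> WF) :
  \sum_(j < p) G j = \sum_(j < p.-1) G j + G p.-1.
Proof. by rewrite -(big_mkord xpredT G) -{1}Ep big_nat_recr //= big_mkord. Qed.

(* As h^p has derivative 0, h^(p-2) (g' h - h' g) = (g h^(p-1))', and derivatives
   have no monomial of degree -1 mod p. *)
Lemma exists_notin_K : exists g, ~ in_K h g.
Proof.
have Ep2 : p.-2.+2 = p by case: (p) (prime_gt1 (pcharf_prime pcharF)) => [|[]].
(* The shift t gives n + t + 1 = p (n + 1), which puts the leading term of q x^t in a degree
   congruent to -1 mod p. *)
pose q := h ^+ p.-2; pose n := (size q).-1; pose t := (p.-1 * n.+1)%N.
exists 'X^t => -[k Ek].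
have Eder : q * 'X^t = (k * h ^+ p.-1)^`().
  have Eexp : h ^+ p.-1 = q * h by rewrite -exprSr -[X in _ ^+ X.-1]Ep2.
  have /eqP : (k * h^`() * q) *+ p == 0 by rewrite (mulrn_poly_eq0 pcharF) dvdnn.
  rewrite -{1}Ep mulrS => /eqP; rewrite addr_eq0 => /eqP Eopp.
  rewrite derivM deriv_exp -/q mulrnAr mulrA Ek Eexp.
  by rewrite -[_ *+ _]opprK -Eopp; ring.
have := congr1 (fun v : {poly F} => v`_(n + t)) Eder.
rewrite coef_deriv coefMXn ltnNge leq_addl addnK /= -mulr_natr.
have /eqP-> : (n + t).+1%:R == 0 :> F.
  rewrite -(dvdn_pcharf pcharF); apply/dvdnP; exists n.+1.
  by rewrite -addSn /t -mulSn Ep mulnC.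
move/eqP; rewrite mulr0 -/(lead_coef q) lead_coef_eq0.
by rewrite (negPf (expf_neq0 _ h0)).
Qed.

Lemma imD2_decomposition w : in_imD2 h w <->
  exists u v, in_gcdJ h p u /\ in_ZKpart h p v /\ w = u + v.
Proof.
rewrite (in_imD2P pcharF h0); split=> [Hw | [u [v [/(in_gcdJP pcharF h0) Hu]]]].
  pose u : WF := \poly_(k < size w) (if (p %| k.+1)%N then 0 else w`_k).
  have Eu k : u`_k = if (p %| k.+1)%N then 0 else w`_k.
    by rewrite coef_poly; case: ltnP => // /(nth_default 0)->; rewrite if_same.
  exists u, (w - u); split; [|split; last by rewrite addrC subrK].
    apply/(in_gcdJP pcharF h0) => k; have := Hw k; rewrite Eu.
    by case: ifP => // _ _; rewrite dvdp0.
  apply/(in_ZKpartP pcharF h0); split=> k.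
    have := Hw k; rewrite coefB Eu; case: ifP => _; first by rewrite subr0.
    by exists 0; rewrite ?mul0r ?subrr //; apply: in_K0.
  by move=> /negPf pk; rewrite coefB Eu pk subrr.
move=> [/(in_ZKpartP pcharF h0)[Kv v0] ->] k; rewrite coefD; case: ifPn => pk.
  by rewrite (Hu k).2 // add0r; apply: Kv.
by rewrite v0 // addr0 (Hu k).1.
Qed.

Lemma imD2_direct w : in_gcdJ h p w -> in_ZKpart h p w -> w = 0.
Proof.
move=> /(in_gcdJP pcharF h0) Hu /(in_ZKpartP pcharF h0)[_ v0].
apply/polyP=> k; rewrite coef0.
by have [/(Hu k).2 | /v0] := boolP (p %| k.+1)%N.
Qed.

Lemma in_gcdJ_J u : in_gcdJ h p u -> in_J h p u.
Proof.
move=> /(in_gcdJP pcharF h0) Hu; apply/(in_JP pcharF h0).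
split=> [|k]; last exact: (Hu k).2.
by apply/inAP => k; apply: dvdp_trans (Hu k).1; rewrite dvdp_mull.
Qed.

Lemma in_ZK_CAx c : in_ZK h c -> in_CAx h c.
Proof.
move=> /(in_ZKP pcharF h0)[dc Kc]; apply/in_CAxP; split=> //.
by apply/inAP => k; have [g _ ->] := Kc k; rewrite dvdp_mull.
Qed.

Definition J_part w : WF := \sum_(j < p.-1) CAx_coef h p j w * hy h j.

Local Notation top_coef := (CAx_coef h p p.-1).

Lemma in_J_part w : in_A h w -> in_J h p (J_part w).
Proof.
move=> Aw; exists (CAx_coef h p ^~ w); split=> [j|]; first exact: in_CAx_coef.
apply: eq_bigr => j _; rewrite wmul_CAx //.
by have /in_CAxP[] := in_CAx_coef pcharF h0 j Aw.
Qed.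

Lemma J_top_decomposition w : in_A h w ->
  w = J_part w + wmul (top_coef w) (hy h p.-1).
Proof.
move=> Aw; have /in_CAxP[_ dc] := in_CAx_coef pcharF h0 p.-1 Aw.
rewrite wmul_CAx // {1}(CAx_decomposition pcharF h0 Aw).
exact: (sum_ord_p (fun j => CAx_coef h p j w * hy h j)).
Qed.

Lemma J_top_unique u c : in_J h p u -> in_CAx h c ->
  J_part (u + wmul c (hy h p.-1)) = u /\ top_coef (u + wmul c (hy h p.-1)) = c.
Proof.
move=> [e [Ce ->]] Cc; pose e' j := if j == p.-1 then c else e j.
have Ce' j : in_CAx h (e' j) by rewrite /e'; case: ifP.
have -> : \sum_(j < p.-1) wmul (e j) (hy h j) = \sum_(j < p.-1) e' j * hy h j.
  apply: eq_bigr => j _; rewrite /e' ltn_eqF // wmul_CAx //.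
  by have /in_CAxP[] := Ce j.
have -> : wmul c (hy h p.-1) = e' p.-1 * hy h p.-1.
  by rewrite /e' eqxx wmul_CAx //; have /in_CAxP[] := Cc.
rewrite -(sum_ord_p (fun j => e' j * hy h j)).
have E j : (j < p)%N -> CAx_coef h p j (\sum_(i < p) e' i * hy h i) = e' j.
  exact: (CAx_coef_sum pcharF h0).
split; last by rewrite E ?Ep // /e' eqxx.
by apply: eq_bigr => j _; rewrite E // (leq_trans (ltn_ord j)) ?leq_pred.
Qed.

Lemma CAx_coefD j w1 w2 :
  CAx_coef h p j (w1 + w2) = CAx_coef h p j w1 + CAx_coef h p j w2.
Proof.
apply/polyP=> k; rewrite coefD !coef_CAx_coef coefD.
by case: ifP; rewrite ?addr0 ?divpD.
Qed.

(** Multiplying the expansion of w by z gives an expansion of z w with coefficients in C_A(x), and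
    such expansions are unique. *)
Lemma CAx_coefZ z j w : in_ZA h z -> in_A h w -> (j < p)%N ->
  CAx_coef h p j (wmul z w) = wmul z (CAx_coef h p j w).
Proof.
move=> /(in_ZAP h0)[Az dz _] Aw lt_jp; rewrite !wmul_CAx //.
rewrite {1}(CAx_decomposition pcharF h0 Aw) mulr_sumr.
under eq_bigr do rewrite mulrA.
apply: (CAx_coef_sum pcharF h0 (c := fun i => z * CAx_coef h p i w)) => // i.
have /in_CAxP[Ac dc] := in_CAx_coef pcharF h0 i Aw.
apply/in_CAxP; split; first by rewrite -wmul_CAx //; apply: inA_mul.
by rewrite derivM dz dc mul0r mulr0 addr0.
Qed.

Lemma in_gcdJ0 : in_gcdJ h p 0.
Proof. by apply/(in_gcdJP pcharF h0) => k; rewrite coef0 dvdp0. Qed.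

Lemma in_ZK0 : in_ZK h 0.
Proof. by exists [::]; rewrite big_nil; split. Qed.

Lemma modN_refl (u : W F * W F) : modN h p u u.
Proof. by rewrite /modN !subrr; split; [apply: in_gcdJ0 | apply: in_ZK0]. Qed.

Lemma coboundary_deviation f : cocycle2 h f ->
  coboundary2 h f <-> in_imD2 h (deviation h f).
Proof.
move=> fC; split=> [[t [tA [tL fE]]] | [al [be [Aal [Abe Ef]]]]].
  exists (t (wx F)), (t (yhat h)).
  by rewrite (deviation_coboundary fE tL); do ![split; [apply: tA; constructor|]].
exact: coboundary_of_deviation Ef.
Qed.

(** The deviation split along A = J + C_A(x) h^(p-1) y^(p-1), a decomposition compatible with that
    of im D_2. *)
Definition HH2_map f : W F * W F :=
  (J_part (deviation h f), top_coef (deviation h f)).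

Lemma HH2_map_iso : HH2_iso h p HH2_map.
Proof.
split; first by move=> f /inA_deviation Ad; split; [apply: in_J_part | apply: in_CAx_coef].
split.
  move=> f g _ _; rewrite /HH2_map deviationD CAx_coefD /J_part.
  by under eq_bigr do rewrite CAx_coefD mulrDl; rewrite big_split; apply: modN_refl.
split.
  move=> z f Zz fC; have Ad := inA_deviation fC; rewrite /HH2_map deviationZ //=.
  rewrite CAx_coefZ ?Ep //.
  have -> : J_part (wmul z (deviation h f)) = wmul z (J_part (deviation h f)).
    rewrite /J_part wmul_sumr; apply: eq_bigr => j _.
    have /(in_ZAP h0)[_ dz _] := Zz.
    by rewrite CAx_coefZ // ?(leq_trans (ltn_ord j)) ?leq_pred // !wmul_CAx // -mulrA.
  exact: modN_refl.
split.
  move=> u c Ju Cc; pose m := u + wmul c (hy h p.-1).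
  have Am : in_A h m.
    apply: inA_add; first by have /(in_JP pcharF h0)[] := Ju.
    by apply: inA_mul (inA_hy h _); have [] := Cc.
  exists (ore_cocycle h m); split; first exact: ore_is_cocycle.
  rewrite /HH2_map deviation_ore //; have [-> ->] := J_top_unique Ju Cc.
  exact: modN_refl.
move=> f fC; have Ad := inA_deviation fC.
rewrite coboundary_deviation // imD2_decomposition /modN /= !subr0.
split=> [[Ju Kc] | [u [v [Ju [[c [Kc ->]] ->]]]]].
  exists (J_part (deviation h f)), (wmul (top_coef (deviation h f)) (hy h p.-1)).
  split=> //; split; last exact: J_top_decomposition.
  by exists (top_coef (deviation h f)).
by have [-> ->] := J_top_unique (in_gcdJ_J Ju) (in_ZK_CAx Kc).
Qed.

(** A polynomial g outside K makes g h^(p-1) y^(p-1) a deviation outside im D_2, as the coefficient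
    of y^(p-1) shows. *)
Lemma exists_non_coboundary : exists f, cocycle2 h f /\ ~ coboundary2 h f.
Proof.
have [g notKg] := exists_notin_K; pose m := wmul (wpol g) (hy h p.-1).
have Am : in_A h m by apply: inA_mul; [apply: inA_wpol | apply: inA_hy].
have mC := ore_is_cocycle h0 Am; exists (ore_cocycle h m); split=> //.
rewrite coboundary_deviation // deviation_ore // => /(in_imD2P pcharF h0)/(_ p.-1).
rewrite Ep dvdnn /m wmulPl coefZhy eqxx => -[k Kk] /(mulIf (expf_neq0 _ h0)) Egk.
by apply: notKg; rewrite Egk.
Qed.

End SecondCohomology.

Theorem theorem3p6 (F : fieldType) (p : nat) (h : {poly F}) :
  p \in [pchar F] -> h != 0 ->
  ((forall w : W F, in_imD2 h w <->
      exists u v, in_gcdJ h p u /\ in_ZKpart h p v /\ w = u + v) /\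
   (forall w : W F, in_gcdJ h p w -> in_ZKpart h p w -> w = 0)) /\
  (exists Phi, HH2_iso h p Phi) /\
  (exists f, cocycle2 h f /\ ~ coboundary2 h f).
Proof.
move=> pcharF h0; split; [split=> w | split].
- exact: imD2_decomposition.
- exact: imD2_direct.
- by exists (HH2_map p h); apply: HH2_map_iso.
exact: exists_non_coboundary pcharF h0.
Qed.
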